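(* Let $d\ge 2$ and $m\in\mathbb{N}$ with $m\ge 2$, and put $N=m^d$. Then jittered sampling with $N$ points does not minimize the mean ${\mathcal L}_2$-discrepancy among stratified samples from convex equivolume partitions of $[0,1]^d$ into $N$ sets. That is, there exists a convex equivolume partition $\tilde{\mathbf\Omega}=(\tilde\Omega_1,\ldots,\tilde\Omega_N)$ of $[0,1]^d$ such that \[ \mathbb{E}\,{\mathcal L}_2^2({\mathcal P}_{\tilde{\mathbf\Omega}})<\mathbb{E}\,{\mathcal L}_2^2({\mathcal P}_{\mathrm{jit}}), \] where ${\mathcal P}_{\mathrm{jit}}$ is the stratified sample of the jittered partition.
   Context: A partition $\mathbf\Omega=(\Omega_1,\ldots,\Omega_N)$ of a compact convex set $K\subset\mathbb{R}^d$ with $|K|>0$ is a tuple of measurable sets of positive Lebesgue measure with $\Omega_1\cup\cdots\cup\Omega_N=K$ such that two different sets have no interior points in common. It is equivolume if $|\Omega_1|=\cdots=|\Omega_N|$, and convex if every $\Omega_i$ is convex. The stratified sample ${\mathcal P}_{\mathbf\Omega}=\{X_1,\ldots,X_N\}$ consists of independent random points with $X_i$ uniformly distributed in $\Omega_i$. For $K=[0,1]^d$ and a set ${\mathcal P}$ of $N$ points in $[0,1]^d$, the discrepancy function is $d_{\mathcal P}(\mathbf x)=\frac{\#({\mathcal P}\cap[\mathbf 0,\mathbf x])}{N}-\prod_{k=1}^d x_k$ for $\mathbf x\in[0,1]^d$, where $[\mathbf 0,\mathbf x]=\prod_{k=1}^d[0,x_k]$. The ${\mathcal L}_2$-discrepancy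 is ${\mathcal L}_2({\mathcal P})=\big(\int_{[0,1]^d}d_{\mathcal P}(\mathbf x)^2\,\mathrm d\mathbf x\big)^{1/2}$, and $\mathbb{E}\,{\mathcal L}_2^2$ is its mean square over the randomness of the sample. The jittered partition of $[0,1]^d$ with $N=m^d$ sets consists of the $m^d$ closed cubes $\prod_{k=1}^d[(j_k-1)/m,\,j_k/m]$ with $j_k\in\{1,\ldots,m\}$. *)

(* Defs.v *)
From HB Require Import structures.
From mathcomp Require Import all_boot all_order all_algebra.
From mathcomp Require Import all_classical all_reals all_analysis.

Set Implicit Arguments.
Unset Strict Implicit.
Unset Printing Implicit Defensive.

Import Order.TTheory GRing.Theory Num.Theory.
Local Open Scope classical_set_scope.
Local Open Scope ring_scope.

(* Points of R^d are d-tuples of reals; d.-tuple R carries the product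
   (= Borel) sigma-algebra from the library (measurable_tuple). *)

Section Defs.
Variable R : realType.

(* d-dimensional Lebesgue integral of a nonnegative extended-real function,
   as the iterated one-dimensional Lebesgue integral (Tonelli). *)
Fixpoint leb_int (n : nat) : (n.-tuple R -> \bar R) -> \bar R :=
  match n with
  | 0 => fun f => f [tuple]
  | n'.+1 => fun f =>
      (\int[@lebesgue_measure R]_(t in [set: R])
          leb_int (fun x : n'.-tuple R => f [tuple of t :: x]))%E
  end.

Definition vol (d : nat) (A : set (d.-tuple R)) : \bar R :=
  leb_int (fun x => (\1_A x)%:E).

Definition unit_cube (d : nat) : set (d.-tuple R) :=
  [set x | forall k : 'I_d, 0 <= tnth x k <= 1].

Definition convex_set (d : nat) (A : set (d.-tuple R)) : Prop :=
  forall x y, A x -> A y -> forall t : R, 0 <= t <= 1 ->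
    A [tuple t * tnth x k + (1 - t) * tnth y k | k < d].

(* interior point (sup-norm balls generate the Euclidean topology) *)
Definition interior_pt (d : nat) (A : set (d.-tuple R)) (x : d.-tuple R) : Prop :=
  exists2 e : R, 0 < e & forall y : d.-tuple R,
    (forall k : 'I_d, `|tnth y k - tnth x k| < e) -> A y.

Definition is_partition (d : nat) (K : set (d.-tuple R))
    (Om : seq (set (d.-tuple R))) : Prop :=
  [/\ forall i, (i < size Om)%N ->
         measurable (nth set0 Om i) /\ (0 < vol (nth set0 Om i))%E,
      forall x, K x <-> exists2 i, (i < size Om)%N & nth set0 Om i x
    & forall i j, (i < size Om)%N -> (j < size Om)%N -> i <> j ->
         forall x, ~ (interior_pt (nth set0 Om i) x /\ interior_pt (nth set0 Om j) x)].

Definition equivolume (d : nat) (Om : seq (set (d.-tuple R))) : Prop :=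
  forall i j, (i < size Om)%N -> (j < size Om)%N ->
    vol (nth set0 Om i) = vol (nth set0 Om j).

Definition convex_partition (d : nat) (Om : seq (set (d.-tuple R))) : Prop :=
  forall i, (i < size Om)%N -> convex_set (nth set0 Om i).

(* Expectation of F(X_1, ..., X_N) for independent X_i uniformly distributed
   in the i-th set of Om: integral against the product of the uniform densities
   1_{Omega_i}/|Omega_i|. *)
Fixpoint strat_exp (d : nat) (Om : seq (set (d.-tuple R)))
    (F : seq (d.-tuple R) -> \bar R) : \bar R :=
  match Om with
  | [::] => F [::]
  | A :: Om' =>
      leb_int (fun x : d.-tuple R =>
        ((\1_A x / fine (vol A))%:E * strat_exp Om' (fun s => F (x :: s)))%E)
  end.

Definition anchored_box (d : nat) (x : d.-tuple R) : set (d.-tuple R) :=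
  [set y | forall k : 'I_d, 0 <= tnth y k <= tnth x k].

Definition discr_fun (d : nat) (P : seq (d.-tuple R)) (x : d.-tuple R) : R :=
  (count (fun y => `[< anchored_box x y >]) P)%:R / (size P)%:R
  - \prod_(k < d) tnth x k.

Definition L2_discr_sq (d : nat) (P : seq (d.-tuple R)) : \bar R :=
  leb_int (fun x => ((\1_(@unit_cube d) x) * discr_fun P x ^+ 2)%:E).

Definition mean_L2_discr_sq (d : nat) (Om : seq (set (d.-tuple R))) : \bar R :=
  strat_exp Om (@L2_discr_sq d).

Definition jitter_cell (d m : nat) (j : {ffun 'I_d -> 'I_m}) : set (d.-tuple R) :=
  [set x | forall k : 'I_d,
     (j k)%:R / m%:R <= tnth x k <= (j k).+1%:R / m%:R].

Definition jittered (d m : nat) : seq (set (d.-tuple R)) :=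
  [seq jitter_cell j | j <- enum {ffun 'I_d -> 'I_m}].

End Defs.

Arguments unit_cube {R} d.
Arguments jittered {R} d m.

(* Main.v *)
(** For an equivolume partition, the number of sample points in [0,x] is a sum
    of independent Bernoulli variables with success probabilities
    p_i(x) = |Omega_i \cap [0,x]| / |Omega_i|, so the mean squared discrepancy is
    the integral of (sum p_i / N - prod x_k)^2 + (sum p_i (1 - p_i)) / N^2.
    Recutting the union B of two neighbouring cubes into two halves of equal
    volume preserves p_1 + p_2, and hence only changes the integral of
    -(p_1 - p_2)^2 / (2 N^2).  Take for B the two cubes with first coordinate in
    [0, 2h] (h = 1/m) and all other coordinates in the last interval [1-h, 1],
    and recut B along the diagonal x_0 / 2 + x_1 = 1.  Up to a common factor
    coming from the remaining coordinates, the integral of (|Omega_1 \cap [0,x]| -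
    |Omega_2 \cap [0,x]|)^2 is 2 h^6 / 9 for the cubes, while the part of it with
    x_0 / 2 + x_1 >= 1 is already 4 h^6 / 15 for the diagonal cut. *)

Require Import Defs.
From HB Require Import structures.
From mathcomp Require Import all_boot all_order all_algebra.
From mathcomp Require Import ring lra.
From mathcomp Require Import all_classical all_reals all_analysis.
From mathcomp Require Import measurable_realfun measurable_fun_approximation.

Set Implicit Arguments.
Unset Strict Implicit.
Unset Printing Implicit Defensive.

Import Order.TTheory GRing.Theory Num.Theory.
Import numFieldNormedType.Exports.
Local Open Scope classical_set_scope.
Local Open Scope ring_scope.

(** * Iterated Lebesgue integrals *)

Section leb_int_theory.
Context {R : realType}.
Notation mu := (@lebesgue_measure R).
Local Open Scope ereal_scope.
Implicit Types n : nat.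

(** The cut is the diagonal from (0, 1) to (2h, 1 - h) of the rectangle that B occupies in
    coordinates 0 and 1. The position of B in coordinate 1 is essential. For x above B in that
    coordinate the cubes would do better: with first coordinate s in [0, 2h] their gap is h min(s,
    2h - s) up to the common factor, against s (2h - s) / 2 for the diagonal pieces. Taking the last
    interval leaves no such x in the unit cube. For x beyond B in coordinate 0 the gap of the cubes
    vanishes, so these points can only favour the diagonal. The estimate discards them together with
    the points below the cut. On the remaining region the gap of the pieces is a single polynomial,
    whose squared integral already exceeds that of the cubes, for every [m] alike. *)

Lemma leb_int_ge0 n (f : n.-tuple R -> \bar R) :
  (forall x, 0 <= f x) -> 0 <= leb_int f.
Proof.
elim: n f => [|n IH] f f0 /=; first exact: f0.
by apply: integral_ge0 => t _; exact: IH.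
Qed.

Lemma leb_int0 n : leb_int (fun _ : n.-tuple R => 0) = 0.
Proof.
by elim: n => [//|n IH] /=; rewrite (eq_integral (cst 0)) ?integral0.
Qed.

Lemma eq_leb_int n (f g : n.-tuple R -> \bar R) :
  f =1 g -> leb_int f = leb_int g.
Proof. by move=> /funext ->. Qed.

(** Transfers one coordinate between the parameter space and the tuple, which is the move behind the
    inductions on dimension below. *)
Lemma measurable_tuple_cons n d (T : measurableType d) :
  measurable_fun [set: (T * R) * n.-tuple R]
    (fun p => (p.1.1, [tuple of p.1.2 :: p.2])).
Proof.
apply: measurable_fun_pair; first exact: measurableT_comp.
by apply: measurable_cons => //; exact: measurableT_comp.
Qed.

(** The parameter space [T] is arbitrary so that the induction can absorb the first coordinate into
    it. The outermost integral is then handled by the measurability part of Tonelli's theorem. *)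
Lemma measurable_leb_int n d (T : measurableType d)
    (f : T * n.-tuple R -> \bar R) :
  measurable_fun [set: T * n.-tuple R] f -> (forall z, 0 <= f z) ->
  measurable_fun [set: T] (fun z => leb_int (fun x => f (z, x))).
Proof.
elim: n d T f => [|n IH] d T f mf f0 /=.
  apply: (measurableT_comp mf); apply: measurable_fun_pair => //.
pose g (p : (T * R) * n.-tuple R) := f (p.1.1, [tuple of p.1.2 :: p.2]).
have mg : measurable_fun setT g.
  by apply: (measurableT_comp mf); exact: measurable_tuple_cons.
apply: (measurable_fun_fubini_tonelli_F (m2 := mu)
  (fun p => leb_int (fun x => g (p, x)))).
  by apply: IH => // z; exact: f0.
by move=> x; apply: leb_int_ge0 => y; exact: f0.
Qed.

Lemma measurable_leb_int_cons n (f : n.+1.-tuple R -> \bar R) :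
  measurable_fun setT f -> (forall z, 0 <= f z) ->
  measurable_fun [set: R] (fun t => leb_int (fun x => f [tuple of t :: x])).
Proof.
move=> mf f0.
apply: (@measurable_leb_int _ _ _ (fun p : R * n.-tuple R => f [tuple of p.1 :: p.2])) => //.
by apply: (measurableT_comp mf); apply: measurable_cons.
Qed.

Lemma measurable_tuple_section n (t : R) (f : n.+1.-tuple R -> \bar R) :
  measurable_fun setT f -> measurable_fun setT (fun x : n.-tuple R => f [tuple of t :: x]).
Proof. by move=> mf; apply: (measurableT_comp mf); apply: measurable_cons. Qed.

Lemma ge0_leb_intD n (f g : n.-tuple R -> \bar R) :
  measurable_fun setT f -> measurable_fun setT g ->
  (forall x, 0 <= f x) -> (forall x, 0 <= g x) ->
  leb_int (fun x => f x + g x) = leb_int f + leb_int g.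
Proof.
elim: n f g => [|n IH] f g mf mg f0 g0 //=.
rewrite -ge0_integralD//; last 4 first.
- by move=> t _; exact: leb_int_ge0.
- exact: measurable_leb_int_cons.
- by move=> t _; exact: leb_int_ge0.
- exact: measurable_leb_int_cons.
by apply: eq_integral => t _; rewrite IH//; exact: measurable_tuple_section.
Qed.

Lemma ge0_leb_intZl n (k : \bar R) (f : n.-tuple R -> \bar R) :
  measurable_fun setT f -> (forall x, 0 <= f x) -> 0 <= k ->
  leb_int (fun x => k * f x) = k * leb_int f.
Proof.
elim: n f => [|n IH] f mf f0 k0 //=.
rewrite -ge0_integralZl//; last 2 first.
- exact: measurable_leb_int_cons.
- by move=> t _; exact: leb_int_ge0.
by apply: eq_integral => t _; rewrite IH//; exact: measurable_tuple_section.
Qed.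

Lemma ge0_le_leb_int n (f g : n.-tuple R -> \bar R) :
  measurable_fun setT f -> measurable_fun setT g ->
  (forall x, 0 <= f x) -> (forall x, f x <= g x) ->
  leb_int f <= leb_int g.
Proof.
elim: n f g => [|n IH] f g mf mg f0 fg; first exact: (fg [tuple]).
have g0 x : 0 <= g x by rewrite (le_trans (f0 x)).
apply: ge0_le_integral => //.
- by move=> t _; exact: leb_int_ge0.
- exact: measurable_leb_int_cons.
- exact: measurable_leb_int_cons.
- by move=> t _; apply: IH => //; exact: measurable_tuple_section.
Qed.

Lemma integral_leb_int_swap n (f : R * n.-tuple R -> \bar R) :
  measurable_fun setT f -> (forall z, 0 <= f z) ->
  \int[mu]_t leb_int (fun x => f (t, x)) =
  leb_int (fun x => \int[mu]_t f (t, x)).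
Proof.
elim: n f => [|n IH] f mf f0 //=.
pose g (p : (R * R) * n.-tuple R) := f (p.1.1, [tuple of p.1.2 :: p.2]).
have mg : measurable_fun setT g.
  by apply: (measurableT_comp mf); exact: measurable_tuple_cons.
rewrite (fubini_tonelli (m1 := mu) (m2 := mu)
  (fun p => leb_int (fun x => g (p, x)))); last 2 first.
- by apply: (measurable_leb_int mg) => z; exact: f0.
- by move=> z; apply: leb_int_ge0 => x; exact: f0.
apply: eq_integral => t _.
rewrite -(IH (fun p => f (p.1, [tuple of t :: p.2])))//.
by apply: (measurableT_comp mf); apply: measurable_fun_pair => //; apply: measurable_cons.
Qed.

(** Tonelli for the iterated integral. It exchanges the integration over a sample point with the one
    over the corner of the anchored box. *)
Lemma leb_int_swap n m (f : n.-tuple R * m.-tuple R -> \bar R) :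
  measurable_fun setT f -> (forall z, 0 <= f z) ->
  leb_int (fun y => leb_int (fun x => f (y, x))) =
  leb_int (fun x => leb_int (fun y => f (y, x))).
Proof.
elim: n f => [|n IH] f mf f0 //=.
pose g (p : (R * m.-tuple R) * n.-tuple R) := f ([tuple of p.1.1 :: p.2], p.1.2).
have mg : measurable_fun setT g.
  apply: (measurableT_comp mf); apply: measurable_fun_pair.
    by apply: measurable_cons => //; exact: measurableT_comp.
  exact: measurableT_comp.
rewrite -(@integral_leb_int_swap _ (fun p => leb_int (fun z => g (p, z))))//.
- apply: eq_integral => t _.
  rewrite (IH (fun p => f ([tuple of t :: p.1], p.2)))//.
  apply: (measurableT_comp mf); apply: measurable_fun_pair => //.
  by apply: measurable_cons.
- by apply: (measurable_leb_int mg) => z; exact: f0.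
- by move=> z; apply: leb_int_ge0 => x; exact: f0.
Qed.

Lemma leb_int_prod n (f : 'I_n -> R -> R) (c : 'I_n -> R) :
  (forall i, measurable_fun setT (f i)) -> (forall i t, (0 <= f i t)%R) ->
  (forall i, \int[mu]_t (f i t)%:E = (c i)%:E) ->
  leb_int (fun x : n.-tuple R => (\prod_(i < n) f i (tnth x i))%:E) =
  (\prod_(i < n) c i)%:E.
Proof.
elim: n f c => [|n IH] f c mf f0 fc /=; first by rewrite !big_ord0.
rewrite big_ord_recl EFinM -fc -(IH (fun i => f (lift ord0 i)))//.
have mp : measurable_fun setT
    (fun x : n.-tuple R => (\prod_(i < n) f (lift ord0 i) (tnth x i))%:E).
  apply/measurable_EFinP; apply: measurable_prod => i _.
  by apply: (measurableT_comp (mf _)); exact: measurable_tnth.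
have p0 (x : n.-tuple R) : 0 <= (\prod_(i < n) f (lift ord0 i) (tnth x i))%:E.
  by rewrite lee_fin; apply: prodr_ge0 => i _.
have mf0 : measurable_fun [set: R] (fun t => (f ord0 t)%:E).
  by apply/measurable_EFinP; exact: mf.
rewrite -ge0_integralZr//; last 2 first.
- by move=> t _; rewrite lee_fin.
- exact: leb_int_ge0.
apply: eq_integral => t _.
rewrite -ge0_leb_intZl//; last by rewrite lee_fin.
apply: eq_leb_int => x; rewrite big_ord_recl EFinM.
by congr (_ * (_)%:E); apply: eq_bigr => i _; rewrite tnthS.
Qed.

End leb_int_theory.

(** * Volumes, and measurability jointly in the sample point and the box corner *)

Section volume.
Context {R : realType} {d : nat}.
Implicit Types A B : set (d.-tuple R).
Local Open Scope ereal_scope.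

Lemma measurable_ge0_set dT (T : measurableType dT) (f : T -> R) :
  measurable_fun setT f -> measurable [set x | (0 <= f x)%R].
Proof.
move=> mf; rewrite [X in measurable X](_ : _ = f @^-1` [set` `[0%R, +oo[]).
  by rewrite -[X in measurable X]setTI; exact: mf.
by apply/seteqP; split => x /=; rewrite in_itv/= andbT.
Qed.

Lemma measurable_forall_ord dT (T : measurableType dT) n (P : 'I_n -> set T) :
  (forall i, measurable (P i)) -> measurable [set x | forall i, P i x].
Proof.
move=> mP; rewrite [X in measurable X](_ : _ = \bigcap_i P i).
  by apply: fin_bigcap_measurable => //; exact: finite_finset.
by apply/seteqP; split => x /= h i; [move=> _; exact: h|exact: h].
Qed.

Lemma measurable_fun_indic dT (T : measurableType dT) (A : set T) :
  measurable A -> measurable_fun setT (fun x => (\1_A x : R)%:E).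
Proof. by move=> mA; apply/measurable_EFinP; exact: measurable_indic. Qed.

Lemma vol_ge0 A : 0 <= vol A.
Proof. by apply: leb_int_ge0 => x; rewrite lee_fin. Qed.

Lemma le_vol A B : measurable A -> measurable B -> A `<=` B -> vol A <= vol B.
Proof.
move=> mA mB AB; apply: ge0_le_leb_int.
- exact: measurable_fun_indic.
- exact: measurable_fun_indic.
- by move=> x; rewrite lee_fin.
- move=> x; rewrite lee_fin !indicE ler_nat.
  case: (boolP (x \in A)) => //; rewrite inE => /AB xB.
  by rewrite mem_set.
Qed.

Lemma volUD A B : measurable A -> measurable B ->
  vol A = vol (A `&` B) + vol (A `\` B).
Proof.
move=> mA mB; rewrite /vol -ge0_leb_intD; first last.
- by move=> x; rewrite lee_fin.
- by move=> x; rewrite lee_fin.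
- by apply: measurable_fun_indic; exact: measurableD.
- by apply: measurable_fun_indic; exact: measurableI.
apply: eq_leb_int => x; rewrite -EFinD !indicE in_setI in_setD.
by case: (x \in A); case: (x \in B); rewrite ?addr0 ?add0r.
Qed.

(** Measurability of each single box would not be enough: Tonelli, and the measurability of volumes
    as functions of the corner, need the relation as a set of pairs. *)
Lemma measurable_anchored_box_rel :
  measurable [set p : d.-tuple R * d.-tuple R | anchored_box p.1 p.2].
Proof.
apply: (measurable_forall_ord (P := fun k =>
  [set p : d.-tuple R * d.-tuple R | 0 <= tnth p.2 k <= tnth p.1 k]%R)) => k.
have m1 : measurable_fun setT (fun p : d.-tuple R * d.-tuple R => tnth p.1 k).
  exact: (measurableT_comp (measurable_tnth k)).
have m2 : measurable_fun setT (fun p : d.-tuple R * d.-tuple R => tnth p.2 k).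
  exact: (measurableT_comp (measurable_tnth k)).
rewrite [X in measurable X](_ : _ =
  [set p : d.-tuple R * d.-tuple R | 0 <= tnth p.2 k]%R `&`
  [set p : d.-tuple R * d.-tuple R | 0 <= tnth p.1 k - tnth p.2 k]%R).
  by apply: measurableI; apply: measurable_ge0_set => //; exact: measurable_funB.
by apply/seteqP; split => p /=; rewrite subr_ge0 => /andP.
Qed.

Lemma measurable_anchored_box (x : d.-tuple R) : measurable (anchored_box x).
Proof.
rewrite -[X in measurable X]setTI.
by apply: (measurable_fun_pair (measurable_cst x) (@measurable_id _ _ setT)) measurable_anchored_box_rel.
Qed.

Lemma measurable_vol_anchored_box A : measurable A ->
  measurable_fun setT (fun x => fine (vol (A `&` anchored_box x))).
Proof.
move=> mA; apply: (measurableT_comp (@fine_measurable _ setT measurableT)).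
pose M := [set p : d.-tuple R * d.-tuple R | anchored_box p.1 p.2] `&` (snd @^-1` A).
have mM : measurable M.
  apply: measurableI; first exact: measurable_anchored_box_rel.
  by rewrite -[X in measurable X]setTI; exact: measurable_snd.
rewrite [X in measurable_fun _ X](_ : _ = fun x => leb_int (fun y => (\1_M (x, y))%:E)).
  apply: (measurable_leb_int (f := fun p => (\1_M p)%:E)).
    exact: measurable_fun_indic.
  by move=> z; rewrite lee_fin.
apply/funext => x; apply: eq_leb_int => y; congr (_%:E).
rewrite !indicE; congr ((nat_of_bool _)%:R).
by apply/idP/idP; rewrite !inE /M /= => -[].
Qed.

End volume.

(** * The mean discrepancy of a stratified sample *)

Section count_expectation.
Context {R : realType}.

(** Expectation of [h] at the number of successes in independent trials with probabilities [ps].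
    Conditioning on the first trial mirrors the recursion of [strat_exp]. *)
Fixpoint bernoulli_sum_exp (ps : seq R) (h : nat -> R) : R :=
  if ps is p :: ps' then
    p * bernoulli_sum_exp ps' (fun k => h k.+1)
      + (1 - p) * bernoulli_sum_exp ps' h
  else h 0.

Lemma bernoulli_sum_exp_ge0 ps h : all (fun p => 0 <= p <= 1) ps ->
  (forall k, 0 <= h k) -> 0 <= bernoulli_sum_exp ps h.
Proof.
elim: ps h => [|p ps IH] h //= /andP[/andP[p0 p1] pps] h0.
by apply: addr_ge0; apply: mulr_ge0; rewrite ?subr_ge0//; exact: IH.
Qed.

(** Squared bias plus variance. The free shift [a] carries the induction: a success in the first
    trial turns [a] into [e + a]. *)
Lemma bernoulli_sum_exp_affine_sqr ps (c a e : R) :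
  bernoulli_sum_exp ps (fun k => c * (e * k%:R + a) ^+ 2) =
  c * ((e * (\sum_(p <- ps) p) + a) ^+ 2
    + e ^+ 2 * \sum_(p <- ps) p * (1 - p)).
Proof.
elim: ps a => [|p ps IH] a /=; first by rewrite !big_nil !mulr0 !addr0.
under [X in bernoulli_sum_exp ps X]eq_fun => k.
  rewrite -addn1 natrD mulrDr mulr1 -addrA.
  over.
rewrite !IH !big_cons; ring.
Qed.

Lemma measurable_bernoulli_sum_exp dT (T : measurableType dT)
    (ps : seq (T -> R)) (h : T -> nat -> R) :
  {in ps, forall p, measurable_fun setT p} ->
  (forall k, measurable_fun setT (h ^~ k)) ->
  measurable_fun setT (fun x => bernoulli_sum_exp [seq p x | p <- ps] (h x)).
Proof.
elim: ps h => [|p ps IH] h mps mh /=; first exact: mh.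
have mp : measurable_fun setT p by apply: mps; rewrite inE eqxx.
have mps' : {in ps, forall p, measurable_fun setT p}.
  by move=> q qps; apply: mps; rewrite inE qps orbT.
apply: measurable_funD; apply: measurable_funM => //.
- exact: (IH (fun x k => h x k.+1)).
- by apply: measurable_funB => //; exact: measurable_cst.
- exact: IH.
Qed.

End count_expectation.

Section stratified_mean.
Context {R : realType} {d : nat}.
Implicit Types (A : set (d.-tuple R)) (Om : seq (set (d.-tuple R))).

Definition box_prob A (x : d.-tuple R) : R :=
  fine (vol (A `&` anchored_box x)) / fine (vol A).

(** Excludes 0 and [+oo], the two volumes that [fine] sends to 0, so that dividing by [fine (vol A)]
    is a true normalization. *)
Definition finite_positive_volume A :=
  measurable A /\ (0 < vol A < +oo)%E.

Local Notation hits x := (fun y : d.-tuple R => `[< anchored_box x y >]).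

Lemma fine_vol_gt0 A : finite_positive_volume A -> 0 < fine (vol A).
Proof. by move=> [_ ?]; exact: fine_gt0. Qed.

Lemma vol_sub_fin A B : finite_positive_volume A -> measurable B -> B `<=` A ->
  vol B \is a fin_num.
Proof.
move=> [mA /andP[_ fA]] mB BA; rewrite ge0_fin_numE ?vol_ge0//.
exact: le_lt_trans (le_vol mB mA BA) fA.
Qed.

Lemma box_prob_compl A x : finite_positive_volume A ->
  fine (vol (A `\` anchored_box x)) / fine (vol A) = 1 - box_prob A x.
Proof.
move=> gA; have [mA _] := gA; have mb := measurable_anchored_box x.
have A0 := fine_vol_gt0 gA.
have fI : vol (A `&` anchored_box x) \is a fin_num.
  by apply: (vol_sub_fin gA); [exact: measurableI|exact: subIsetl].
have fD : vol (A `\` anchored_box x) \is a fin_num.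
  by apply: (vol_sub_fin gA); [exact: measurableD|exact: subDsetl].
have auv : fine (vol A) = fine (vol (A `&` anchored_box x)) +
    fine (vol (A `\` anchored_box x)).
  by rewrite -fineD//; exact: (congr1 fine (volUD mA mb)).
move: A0 auv; rewrite /box_prob.
generalize (fine (vol A)) (fine (vol (A `&` anchored_box x)))
  (fine (vol (A `\` anchored_box x))) => a u v + auv.
by rewrite {a}auv => /lt0r_neq0 ?; field.
Qed.

Lemma box_prob_itv A x : finite_positive_volume A -> 0 <= box_prob A x <= 1.
Proof.
move=> gA; have A0 := fine_vol_gt0 gA; apply/andP; split.
  by apply: divr_ge0; [exact/fine_ge0/vol_ge0|exact: ltW].
rewrite -subr_ge0 -box_prob_compl//.
by apply: divr_ge0; [exact/fine_ge0/vol_ge0|exact: ltW].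
Qed.

Lemma measurable_box_prob A : measurable A -> measurable_fun setT (box_prob A).
Proof.
move=> mA; apply: measurable_funM => //.
exact: measurable_vol_anchored_box.
Qed.

(** Two measurable branches glued along the measurable hit set. Corner [a] and point [b] are both
    functions of [z], to cover a fixed sample point as well as a varying pair. *)
Lemma measurable_hits dT (T : measurableType dT) (a b : T -> d.-tuple R) (g : T -> nat -> R) :
  measurable_fun setT a -> measurable_fun setT b ->
  (forall k, measurable_fun setT (g ^~ k)) ->
  measurable_fun setT (fun z => g z (hits (a z) (b z))).
Proof.
move=> ma mb mg.
pose M := [set z | anchored_box (a z) (b z)].
have mM : measurable M.
  rewrite -[X in measurable X]setTI.
  by apply: (measurable_fun_pair ma mb) measurable_anchored_box_rel.
rewrite [X in measurable_fun _ X](_ : _ = fun z => \1_M z * g z 1 + \1_(~` M) z * g z 0).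
  apply: measurable_funD; apply: measurable_funM => //.
  by apply: measurable_indic; exact: measurableC.
apply/funext => z; rewrite !indicE in_setC.
rewrite (_ : z \in M = hits (a z) (b z)).
  by case: (hits (a z) (b z)); rewrite ?mul1r ?mul0r ?addr0 ?add0r.
by apply/idP/asboolP; rewrite inE.
Qed.

Lemma leb_int_unif A (x : d.-tuple R) (g : nat -> R) : finite_positive_volume A ->
  (forall k, 0 <= g k) ->
  leb_int (fun y => ((\1_A y / fine (vol A)) * g (hits x y))%:E) =
  (box_prob A x * g 1 + (1 - box_prob A x) * g 0)%:E.
Proof.
move=> gA g0; have [mA _] := gA; have mb := measurable_anchored_box x.
have A0 := fine_vol_gt0 gA.
transitivity (leb_int (fun y =>
    (g 1 / fine (vol A))%:E * (\1_(A `&` anchored_box x) y)%:E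
    + (g 0 / fine (vol A))%:E * (\1_(A `\` anchored_box x) y)%:E))%E.
  apply: eq_leb_int => y; rewrite -!EFinM -EFinD; congr (_%:E).
  rewrite !indicE in_setI in_setD.
  rewrite (_ : y \in anchored_box x = hits x y); last by apply/idP/asboolP; rewrite inE.
  by case: (hits x y); case: (y \in A) => /=; ring.
have c0 k : (0 <= (g k / fine (vol A))%:E)%E by rewrite lee_fin divr_ge0// ltW.
have mI : measurable (A `&` anchored_box x) by exact: measurableI.
have mD : measurable (A `\` anchored_box x) by exact: measurableD.
rewrite ge0_leb_intD; first last.
- by move=> y /=; rewrite mule_ge0// lee_fin.
- by move=> y /=; rewrite mule_ge0// lee_fin.
- by apply: emeasurable_funM; [exact: measurable_cst|exact: measurable_fun_indic].
- by apply: emeasurable_funM; [exact: measurable_cst|exact: measurable_fun_indic].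
rewrite !ge0_leb_intZl//; try exact: measurable_fun_indic; try by move=> y; rewrite lee_fin.
rewrite -!/(vol _) -(@fineK _ (vol (A `&` _))); last first.
  by apply: (vol_sub_fin gA) => //; exact: subIsetl.
rewrite -(@fineK _ (vol (A `\` _))); last first.
  by apply: (vol_sub_fin gA) => //; exact: subDsetl.
rewrite -box_prob_compl// -!EFinM -EFinD /box_prob; congr (_%:E).
by ring.
Qed.

(** For a fixed corner [x], each sample point enters only through whether it hits the box, so
    integrating it out is one Bernoulli trial. [H] is general because the induction shifts its count
    by the hit of the first point. *)
Lemma strat_exp_leb_int_count Om (H : d.-tuple R -> nat -> R) :
  {in Om, forall A, finite_positive_volume A} ->
  (forall k, measurable_fun setT (H ^~ k)) -> (forall x k, 0 <= H x k) ->
  strat_exp Om (fun s => leb_int (fun x => (H x (count (hits x) s))%:E)) =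
  leb_int (fun x => (bernoulli_sum_exp [seq box_prob A x | A <- Om] (H x))%:E).
Proof.
elim: Om H => [|A Om IH] H gOm mH H0 //=.
have gA : finite_positive_volume A by apply: gOm; rewrite inE eqxx.
have gOm' : {in Om, forall B, finite_positive_volume B}.
  by move=> B BOm; apply: gOm; rewrite inE BOm orbT.
have A0 := fine_vol_gt0 gA; have [mA _] := gA.
(* Conditional expectation given that the first point contributes [b] to the count. *)
pose G x (b : nat) := bernoulli_sum_exp [seq box_prob B x | B <- Om] (fun k => H x (b + k)%N).
have G0 x b : 0 <= G x b.
  apply: bernoulli_sum_exp_ge0 => //; apply/allP => p /mapP[B BOm ->].
  exact/box_prob_itv/gOm'.
have mG b : measurable_fun setT (G ^~ b).
  rewrite /G; under eq_fun do rewrite (map_comp (fun p => p _) box_prob).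
  apply: (measurable_bernoulli_sum_exp (h := fun x k => H x (b + k)%N)) => //.
  move=> p /mapP[B BOm ->]; apply: measurable_box_prob.
  by have [] := gOm' _ BOm.
transitivity (leb_int (fun y => leb_int (fun x =>
    ((\1_A y / fine (vol A)) * G x (hits x y))%:E))).
  apply: eq_leb_int => y.
  rewrite (IH (fun x k => H x (hits x y + k)%N)) => //; last first.
    move=> k; apply: (measurable_hits (a := id) (b := cst y)
      (g := fun x b => H x (b + k)%N)); [exact: measurable_id|exact: measurable_cst|].
    by move=> b; exact: mH.
  rewrite -ge0_leb_intZl//.
  - apply/measurable_EFinP; apply: (measurable_hits (a := id) (b := cst y) (g := G)) => //.
  - by move=> x; rewrite lee_fin; exact: G0.
  - by rewrite lee_fin divr_ge0// ltW.
rewrite (leb_int_swap (f := fun p => ((\1_A p.1 / fine (vol A)) * G p.2 (hits p.2 p.1))%:E)).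
- by apply: eq_leb_int => x; exact: (leb_int_unif x gA (G0 x)).
- apply/measurable_EFinP; apply: measurable_funM.
    apply: measurable_funM; last exact: measurable_cst.
    have mI : measurable_fun [set: d.-tuple R] (\1_A : _ -> R).
      exact: measurable_indic.
    exact: (measurableT_comp mI).
  apply: (measurable_hits (g := fun p => G p.2)) => // k.
  exact: (measurableT_comp (mG k)).
- by move=> z; rewrite lee_fin mulr_ge0// divr_ge0// ltW.
Qed.

(** Only samples of the right length matter, which turns the [size P] of [discr_fun] into the
    constant N. *)
Lemma eq_strat_exp Om (F G : seq (d.-tuple R) -> \bar R) :
  (forall s, size s = size Om -> F s = G s) -> strat_exp Om F = strat_exp Om G.
Proof.
elim: Om F G => [|A Om IH] F G FG /=; first exact: FG.
apply: eq_leb_int => y; congr (_ * _)%E; apply: IH => s sz.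
by apply: FG; rewrite /= sz.
Qed.

Lemma measurable_unit_cube : measurable (unit_cube d : set (d.-tuple R)).
Proof.
apply: (measurable_forall_ord (P := fun k =>
  [set x : d.-tuple R | 0 <= tnth x k <= 1])) => k.
rewrite [X in measurable X](_ : _ =
  [set x : d.-tuple R | 0 <= tnth x k] `&` [set x : d.-tuple R | 0 <= 1 - tnth x k]).
  apply: measurableI; apply: measurable_ge0_set; first exact: measurable_tnth.
  by apply: measurable_funB; [exact: measurable_cst|exact: measurable_tnth].
by apply/seteqP; split => x /=; rewrite subr_ge0 => /andP.
Qed.

Lemma mean_L2_discr_sqE Om : {in Om, forall A, finite_positive_volume A} ->
  mean_L2_discr_sq Om = leb_int (fun x => (\1_(unit_cube d) x *
    (((\sum_(A <- Om) box_prob A x) / (size Om)%:R - \prod_(k < d) tnth x k) ^+ 2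
     + (\sum_(A <- Om) box_prob A x * (1 - box_prob A x)) / (size Om)%:R ^+ 2))%:E).
Proof.
move=> gOm; set N := (size Om)%:R : R.
pose H (x : d.-tuple R) (k : nat) := \1_(@unit_cube R d) x *
   (N^-1 * k%:R + - \prod_(k < d) tnth x k) ^+ 2.
have mH k : measurable_fun setT (H ^~ k).
  apply: measurable_funM.
    by apply: measurable_indic; exact: measurable_unit_cube.
  apply: measurable_funX; apply: measurable_funD; first exact: measurable_cst.
  apply: measurableT_comp => //; apply: measurable_prod => i _.
  exact: measurable_tnth.
have H0 x k : 0 <= H x k by rewrite mulr_ge0// sqr_ge0.
rewrite /mean_L2_discr_sq.
rewrite (eq_strat_exp (G := fun s => leb_int (fun x => (H x (count (hits x) s))%:E))).
  rewrite strat_exp_leb_int_count//; apply: eq_leb_int => x; congr (_%:E).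
  rewrite bernoulli_sum_exp_affine_sqr !big_map exprVn.
  by congr (_ * (_ ^+ 2 + _)); rewrite mulrC.
move=> s sz; apply: eq_leb_int => x.
by rewrite /H /discr_fun sz [_^-1 * _]mulrC.
Qed.

End stratified_mean.

(** * Replacing two strata *)

Section boxes.
Context {R : realType}.
Notation mu := (@lebesgue_measure R).

Lemma integral_indic_itv (a b : R) :
  (\int[mu]_t (\1_[set` `[a, b]] t)%:E = (Num.max 0 (b - a))%:E)%E.
Proof.
transitivity (mu [set` `[a, b]]).
  have := @integral_indic _ _ R mu setT measurableT [set` `[a, b]].
  by rewrite setIT; apply; exact: measurable_itv.
rewrite lebesgue_measure_itv/= lte_fin.
case: ltP => ab; first by rewrite -EFinB max_r// subr_ge0 ltW.
by rewrite max_l// subr_le0.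
Qed.

Lemma indic_box d (lo hi : 'I_d -> R) (y : d.-tuple R) :
  \1_[set z : d.-tuple R | forall k, lo k <= tnth z k <= hi k] y =
  \prod_(k < d) \1_[set` `[lo k, hi k]] (tnth y k) :> R.
Proof.
rewrite indicE.
case: (pselect (forall k, lo k <= tnth y k <= hi k)) => yb.
  by rewrite mem_set// big1// => k _; rewrite indicE mem_set//= in_itv/=.
rewrite memNset//.
move/existsNP: yb => [k yk].
by rewrite (bigD1 k)//= indicE memNset ?mul0r//= in_itv/=.
Qed.

Lemma measurable_box d (lo hi : 'I_d -> R) :
  measurable [set z : d.-tuple R | forall k, lo k <= tnth z k <= hi k].
Proof.
apply: (measurable_forall_ord (P := fun k =>
  [set z : d.-tuple R | lo k <= tnth z k <= hi k])) => k.
rewrite [X in measurable X](_ : _ = (fun z => tnth z k) @^-1` [set` `[lo k, hi k]]).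
  by rewrite -[X in measurable X]setTI; exact: measurable_tnth.
by apply/seteqP; split => x /=; rewrite in_itv.
Qed.

(** The truncation at 0 covers empty sides, which occur when an anchored box ends below [lo k]. *)
Lemma vol_box d (lo hi : 'I_d -> R) :
  vol [set z : d.-tuple R | forall k, lo k <= tnth z k <= hi k] =
  (\prod_(k < d) Num.max 0 (hi k - lo k))%:E.
Proof.
rewrite -(leb_int_prod (f := fun k => \1_[set` `[lo k, hi k]])).
- by apply: eq_leb_int => y; rewrite indic_box.
- by move=> k; exact: measurable_indic.
- by [].
- by move=> k; exact: integral_indic_itv.
Qed.

End boxes.

Section swap_two_cells.
Context {R : realType} {d : nat} {I : finType}.
Implicit Types Om : I -> set (d.-tuple R).

Definition stratum_gap Om (i j : I) (x : d.-tuple R) : R :=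
  \1_(unit_cube d) x * ((box_prob (Om i) x - box_prob (Om j) x) ^+ 2
                        / (2 * #|I|%:R ^+ 2)).

Definition discr_density Om (x : d.-tuple R) : R := \1_(unit_cube d) x *
  (((\sum_k box_prob (Om k) x) / #|I|%:R - \prod_(k < d) tnth x k) ^+ 2
     + (\sum_k box_prob (Om k) x * (1 - box_prob (Om k) x)) / #|I|%:R ^+ 2).

Lemma mean_L2_discr_sq_enum Om : (forall k, finite_positive_volume (Om k)) ->
  mean_L2_discr_sq [seq Om k | k <- enum I] =
  leb_int (fun x => (discr_density Om x)%:E).
Proof.
move=> gOm; rewrite mean_L2_discr_sqE; last by move=> A /mapP[k _ ->].
apply: eq_leb_int => x.
rewrite /discr_density size_map -cardE !big_map.
by rewrite -!enumT !big_enum.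
Qed.

Lemma measurable_stratum_gap Om i j : (forall k, measurable (Om k)) ->
  measurable_fun setT (stratum_gap Om i j).
Proof.
move=> mOm; apply: measurable_funM.
  by apply: measurable_indic; exact: measurable_unit_cube.
apply: measurable_funM => //; apply: measurable_funX.
by apply: measurable_funB; exact: measurable_box_prob.
Qed.

Lemma measurable_discr_density Om : (forall k, measurable (Om k)) ->
  measurable_fun setT (discr_density Om).
Proof.
move=> mOm; apply: measurable_funM.
  by apply: measurable_indic; exact: measurable_unit_cube.
apply: measurable_funD.
  apply: measurable_funX; apply: measurable_funB.
    apply: measurable_funM => //; apply: measurable_sum => k.
    exact: measurable_box_prob.
  by apply: measurable_prod => k _; exact: measurable_tnth.
apply: measurable_funM => //; apply: measurable_sum => k.
apply: measurable_funM; first exact: measurable_box_prob.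
by apply: measurable_funB => //; exact: measurable_box_prob.
Qed.

Lemma discr_density_ge0 Om x : (forall k, finite_positive_volume (Om k)) ->
  0 <= discr_density Om x.
Proof.
move=> gOm; apply: mulr_ge0 => //; apply: addr_ge0; first exact: sqr_ge0.
apply: divr_ge0; last exact: sqr_ge0.
apply: sumr_ge0 => k _; have /andP[p0 p1] := box_prob_itv x (gOm k).
by rewrite mulr_ge0// subr_ge0.
Qed.

Lemma stratum_gap_ge0 Om i j x : 0 <= stratum_gap Om i j x.
Proof.
apply: mulr_ge0 => //; apply: divr_ge0; first exact: sqr_ge0.
by rewrite mulr_ge0// sqr_ge0.
Qed.

(* With p + q fixed, [p (1 - p) + q (1 - q)] decreases as [(p - q) ^ 2 / 2]
   grows, and the bias term depends on p + q only. *)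
Lemma discr_density_swap Om Om' i j x : (i != j) ->
  (forall k, k != i -> k != j -> Om' k = Om k) ->
  box_prob (Om' i) x + box_prob (Om' j) x = box_prob (Om i) x + box_prob (Om j) x ->
  discr_density Om' x + stratum_gap Om' i j x =
  discr_density Om x + stratum_gap Om i j x.
Proof.
move=> ij eOm epq.
have I0 : #|I|%:R != 0 :> R by rewrite pnatr_eq0 -lt0n; apply/card_gt0P; exists i.
have split (F : I -> R) : \sum_k F k =
    F i + F j + \sum_(k | (k != i) && (k != j)) F k.
  by rewrite (bigD1 i)//= (bigD1 j)/= 1?eq_sym// addrA.
have rest (F : set (d.-tuple R) -> R) :
    \sum_(k | (k != i) && (k != j)) F (Om' k) =
    \sum_(k | (k != i) && (k != j)) F (Om k).
  by apply: eq_bigr => k /andP[ki kj]; rewrite eOm.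
rewrite /discr_density /stratum_gap !split (rest (fun A => box_prob A x)).
rewrite (rest (fun A => box_prob A x * (1 - box_prob A x))) epq -!mulrDr.
congr (_ * _); rewrite -!addrA; congr (_ + _).
have -> : box_prob (Om' i) x = box_prob (Om i) x + box_prob (Om j) x - box_prob (Om' j) x.
  by rewrite -epq addrK.
by field.
Qed.

(** Bias and variance terms are each at most 1. The crude bound serves to make the mean discrepancy
    finite, hence cancellable in the extended reals. *)
Lemma discr_density_le Om x : (forall k, finite_positive_volume (Om k)) ->
  discr_density Om x <= 2 * \1_(unit_cube d) x.
Proof.
move=> gOm; rewrite /discr_density indicE.
case: (boolP (x \in _)) => [|_]; last by rewrite mul0r mulr0.
rewrite inE mul1r mulr1 => xc.
have p01 k : 0 <= box_prob (Om k) x <= 1 := box_prob_itv x (gOm k).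
have /andP[b0 b1] : 0 <= \prod_(k < d) tnth x k <= 1.
  apply/andP; split; first by apply: prodr_ge0 => k _; have /andP[] := xc k.
  by rewrite prodr_ile1.
(* For an empty index type both quotients are 0 by the convention on division by 0, and only the
   squared product of coordinates is left. *)
case: (posnP #|I|) => [I0|I0].
  have E F : \sum_(k : I) F k = 0 :> R.
    by apply: big1 => k _; have := fintype0 k I0.
  rewrite !E I0 !mul0r addr0 sub0r sqrrN.
  by nra.
have N0 : 0 < #|I|%:R :> R by rewrite ltr0n.
have N1 : 1 <= #|I|%:R :> R by rewrite ler1n.
have bound (F : I -> R) : (forall k, 0 <= F k <= 1) ->
    0 <= (\sum_k F k) / #|I|%:R <= 1.
  move=> F01; apply/andP; split.
    by rewrite divr_ge0// sumr_ge0// => k _; have /andP[] := F01 k.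
  rewrite ler_pdivrMr// mul1r (le_trans (y := \sum_(k : I) 1))//.
    by apply: ler_sum => k _; have /andP[] := F01 k.
  by rewrite sumr_const.
have /andP[s0 s1] := bound _ p01.
have /andP[t0 t1] : 0 <= (\sum_k box_prob (Om k) x * (1 - box_prob (Om k) x)) / #|I|%:R <= 1.
  apply: bound => k; have /andP[u0 u1] := p01 k; apply/andP; split; nra.
rewrite (_ : 2 = 1 + 1 :> R)//; apply: lerD; first by nra.
rewrite expr2 invfM mulrA ler_pdivrMr// mul1r (le_trans t1)//.
Qed.

Lemma vol_unit_cube : vol (unit_cube d : set (d.-tuple R)) = 1%:E.
Proof.
rewrite [X in vol X](_ : _ = [set z : d.-tuple R | forall k, 0 <= tnth z k <= 1])//.
rewrite (vol_box (fun=> 0) (fun=> 1)) big1// => k _.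
by rewrite subr0 max_r.
Qed.

Lemma mean_L2_discr_sq_lt Om Om' i j : (i != j) ->
  (forall k, finite_positive_volume (Om k)) ->
  (forall k, finite_positive_volume (Om' k)) ->
  (forall k, k != i -> k != j -> Om' k = Om k) ->
  (forall x, box_prob (Om' i) x + box_prob (Om' j) x
             = box_prob (Om i) x + box_prob (Om j) x) ->
  (leb_int (fun x => (stratum_gap Om i j x)%:E)
    < leb_int (fun x => (stratum_gap Om' i j x)%:E))%E ->
  (mean_L2_discr_sq [seq Om' k | k <- enum I]
    < mean_L2_discr_sq [seq Om k | k <- enum I])%E.
Proof.
move=> ij gOm gOm' eOm epq gap; rewrite !mean_L2_discr_sq_enum//.
have mOm k : measurable (Om k) by have [] := gOm k.
have mOm' k : measurable (Om' k) by have [] := gOm' k.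
have mdens O : (forall k, measurable (O k)) ->
    measurable_fun setT (fun x => (discr_density O x)%:E).
  by move=> mO; apply/measurable_EFinP; exact: measurable_discr_density.
have dens0 O x : (forall k, finite_positive_volume (O k)) ->
    (0 <= (discr_density O x)%:E)%E.
  by move=> gO; rewrite lee_fin discr_density_ge0.
(* The balance is kept as an equality of sums of nonnegative integrals, since differences of
   possibly infinite integrals are not additive. *)
have : (leb_int (fun x => (discr_density Om' x)%:E)
      + leb_int (fun x => (stratum_gap Om' i j x)%:E)
    = leb_int (fun x => (discr_density Om x)%:E)
      + leb_int (fun x => (stratum_gap Om i j x)%:E))%E.
  have mgap O : (forall k, measurable (O k)) ->
      measurable_fun setT (fun x => (stratum_gap O i j x)%:E).
    by move=> mO; apply/measurable_EFinP; exact: measurable_stratum_gap.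
  have gap0 O x : (0 <= (stratum_gap O i j x)%:E)%E by rewrite lee_fin stratum_gap_ge0.
  rewrite -(ge0_leb_intD (mdens _ mOm') (mgap _ mOm') (fun x => dens0 _ x gOm') (gap0 Om')).
  rewrite -(ge0_leb_intD (mdens _ mOm) (mgap _ mOm) (fun x => dens0 _ x gOm) (gap0 Om)).
  by apply: eq_leb_int => x; rewrite -!EFinD (discr_density_swap ij eOm (epq x)).
have fin (O : I -> set (d.-tuple R)) : (forall k, finite_positive_volume (O k)) ->
    leb_int (fun x => (discr_density O x)%:E) \is a fin_num.
  move=> gO; have mO k : measurable (O k) by have [] := gO k.
  rewrite ge0_fin_numE; last by apply: leb_int_ge0 => x; rewrite lee_fin discr_density_ge0.
  apply: (@le_lt_trans _ _ (leb_int (fun x => 2%:E * (\1_(@unit_cube R d) x)%:E)%E)).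
    apply: ge0_le_leb_int.
    - exact: mdens.
    - apply: emeasurable_funM; first exact: measurable_cst.
      by apply: measurable_fun_indic; exact: measurable_unit_cube.
    - by move=> x; rewrite lee_fin discr_density_ge0.
    - by move=> x; rewrite -EFinM lee_fin discr_density_le.
  have mcube : measurable_fun setT (fun x : d.-tuple R => (\1_(@unit_cube R d) x : R)%:E).
    by apply: measurable_fun_indic; exact: measurable_unit_cube.
  rewrite (ge0_leb_intZl mcube)//.
  by have := vol_unit_cube; rewrite /vol => ->; rewrite -EFinM ltry.
have := fin _ gOm; have := fin _ gOm'; move: gap.
have : (0 <= leb_int (fun x => (stratum_gap Om i j x)%:E))%E.
  by apply: leb_int_ge0 => x; rewrite lee_fin stratum_gap_ge0.
(* Finiteness of the two means, the balance and the strict inequality together exclude infinite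
   gaps. *)
generalize (leb_int (fun x => (stratum_gap Om i j x)%:E))
  (leb_int (fun x => (stratum_gap Om' i j x)%:E))
  (leb_int (fun x => (discr_density Om x)%:E))
  (leb_int (fun x => (discr_density Om' x)%:E)).
move=> [a| |] [b| |] [u| |] [v| |]//=.
by rewrite -!EFinD !lte_fin => _ ab _ _ [] ?; lra.
Qed.

End swap_two_cells.

(** * One-dimensional integrals *)

Section interval_integrals.
Context {R : realType}.
Notation mu := (@lebesgue_measure R).
Implicit Types (a b c t : R) (f : R -> R).

Lemma integral_itv_deriv (p : {poly R}) a b : a <= b ->
  (\int[mu]_(u in `[a, b]) (p^`().[u])%:E = (p.[b] - p.[a])%:E)%E.
Proof.
rewrite le_eqVlt => /predU1P[<-|ab].
  by rewrite set_itv1 integral_set1 subrr.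
rewrite EFinB; apply: continuous_FTC2 => //.
- by apply: continuous_subspaceT => x; exact: continuous_horner.
- split.
  + by move=> x _; exact: derivable_horner.
  + by apply: cvg_at_right_filter; exact: continuous_horner.
  + by apply: cvg_at_left_filter; exact: continuous_horner.
- by move=> x _; rewrite -derivE.
Qed.

(** [c] lists coefficients from degree 0 upwards. With an explicit list, both side conditions become
    identities for [ring] or [field]. *)
Lemma integral_itv_poly (c : seq R) f v a b : a <= b ->
  (forall u, f u = \sum_(i < size c) c`_i * u ^+ i) ->
  v = \sum_(i < size c) c`_i / i.+1%:R * (b ^+ i.+1 - a ^+ i.+1) ->
  (\int[mu]_(u in `[a, b]) (f u)%:E = v%:E)%E.
Proof.
move=> ab fE ->.
pose p : {poly R} := \sum_(i < size c) (c`_i / i.+1%:R) *: 'X^(i.+1).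
have pE u : p.[u] = \sum_(i < size c) c`_i / i.+1%:R * u ^+ i.+1.
  by rewrite horner_sum; apply: eq_bigr => i _; rewrite hornerZ hornerXn.
transitivity (\int[mu]_(u in `[a, b]) (p^`().[u])%:E)%E.
  apply: eq_integral => u _; congr (_%:E); rewrite fE.
  rewrite raddf_sum horner_sum; apply: eq_bigr => i _.
  rewrite /= derivZ derivXn hornerZ hornerMn hornerXn -(mulr_natl (_ ^+ _)) mulrA divfK//.
rewrite integral_itv_deriv// !pE -sumrB; congr (_%:E).
by apply: eq_bigr => i _; rewrite mulrBr.
Qed.

Lemma ge0_integral_itv_split f a c b : a <= c <= b -> measurable_fun setT f ->
  (forall u, 0 <= f u) ->
  (\int[mu]_(u in `[a, b]) (f u)%:E =
   \int[mu]_(u in `[a, c]) (f u)%:E + \int[mu]_(u in `[c, b]) (f u)%:E)%E.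
Proof.
move=> /andP[ac cb] mf f0.
have mfE D : measurable_fun D (fun u => (f u)%:E).
  by apply: measurable_funTS; apply/measurable_EFinP.
rewrite -[X in (_ = _ + X)%E]integral_itv_obnd_cbnd//.
rewrite -ge0_integral_setU//=.
- by congr integral; rewrite -itv_bndbnd_setU// ?bnd_simp.
- exact: mfE.
- by move=> u _; rewrite lee_fin.
- apply/disj_set2P/seteqP; split => // u [] /=; rewrite !in_itv/=.
  by move=> /andP[_ uc] /andP[cu _]; move: cu; rewrite ltNge uc.
Qed.

Lemma integral_indic_mul f a b :
  (\int[mu]_u (\1_[set` `[a, b]] u * f u)%:E = \int[mu]_(u in `[a, b]) (f u)%:E)%E.
Proof.
rewrite [RHS]integral_mkcond; apply: eq_integral => u _.
by rewrite /patch indicE; case: ifP => _; rewrite ?mul1r ?mul0r.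
Qed.

Lemma integral_sqr_ramp (h : R) : 0 <= h ->
  (\int[mu]_(t in `[(1 - h)%R, 1%R]) ((t - (1 - h)) ^+ 2)%:E = (h ^+ 3 / 3)%:E)%E.
Proof.
move=> h0; apply: (integral_itv_poly (c := [:: (1 - h) ^+ 2; - 2 * (1 - h); 1])).
- by rewrite gerBl.
- by move=> u; rewrite !big_ord_recl big_ord0 /= /bump /= ?add1n; ring.
- by rewrite !big_ord_recl big_ord0 /= /bump /= ?add1n; field.
Qed.

(** Planar area below the diagonal and below the corner (s, y): the rectangle of sides s and y - (1
    - h), minus the triangle above the cut, whose legs are 2 (s/2 + y - 1) and s/2 + y - 1. *)
Lemma integral_cut_strip (h s y : R) : s <= 2 * h -> 1 - h <= y <= 1 ->
  1 <= s / 2 + y ->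
  (\int[mu]_(u in `[0%R, s]) (Num.max 0 (Num.min y (1 - u / 2) - (1 - h)))%:E
   = (s * (y - (1 - h)) - (s / 2 + y - 1) ^+ 2)%:E)%E.
Proof.
move=> sh /andP[hy y1] sy.
(* The cut reaches height [y] at abscissa 2 (1 - y); to the left of it the corner bounds the slice,
   to the right the cut does. *)
have s0 : 0 <= 2 * (1 - y) <= s by apply/andP; split; lra.
rewrite (ge0_integral_itv_split s0); last 2 first.
- apply: measurable_maxr => //; apply: measurable_funB => //.
  apply: measurable_minr => //; apply: measurable_funB => //.
  by apply: measurable_funM => //; exact: measurable_id.
- by move=> u; rewrite le_max lexx.
have /andP[s00 s0s] := s0.
rewrite (_ : (s * (y - (1 - h)) - (s / 2 + y - 1) ^+ 2) =
  (2 * (1 - y) * (y - (1 - h))) + (h * (s - 2 * (1 - y)) - (s ^+ 2 - (2 * (1 - y)) ^+ 2) / 4)).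
  rewrite EFinD; congr (_ + _)%E.
  - transitivity (\int[mu]_(u in `[0%R, (2 * (1 - y))%R]) (y - (1 - h))%:E)%E.
      apply: eq_integral => u; rewrite inE /= in_itv/= => /andP[u0 us].
      by rewrite min_l ?max_r//; lra.
    apply: (integral_itv_poly (c := [:: y - (1 - h)])) => //.
    + by move=> u; rewrite !big_ord_recl big_ord0 /= /bump /= ?add1n; ring.
    + by rewrite !big_ord_recl big_ord0 /= /bump /= ?add1n; field.
  - transitivity (\int[mu]_(u in `[(2 * (1 - y))%R, s]) (h - u / 2)%:E)%E.
      apply: eq_integral => u; rewrite inE /= in_itv/= => /andP[u0 us].
      rewrite min_r; last by lra.
      rewrite max_r; last by lra.
      by congr (_%:E); ring.
    apply: (integral_itv_poly (c := [:: h; - (1 / 2)])) => //.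
    + by move=> u; rewrite !big_ord_recl big_ord0 /= /bump /= ?add1n; field.
    + by rewrite !big_ord_recl big_ord0 /= /bump /= ?add1n; field.
by field.
Qed.

(** The integrand is the squared gap of the pieces (twice the lower area minus the total area), and
    the range of [y] is the part above the cut. *)
Lemma integral_sqr_cut_gap_inner (h s : R) : 0 <= s ->
  (\int[mu]_(y in `[(1 - s / 2)%R, 1%R])
     ((s * (y - (1 - h)) - 2 * (s / 2 + y - 1) ^+ 2) ^+ 2)%:E
   = (h ^+ 2 * s ^+ 3 / 2 - 5 / 12 * h * s ^+ 4 + 7 / 80 * s ^+ 5)%:E)%E.
Proof.
move=> s0.
(* As a polynomial in y, the gap before squaring is A y^2 + B y + C. *)
pose A : R := - 2; pose B := s + 4 * (1 - s / 2).
pose C := - s * (1 - h) - 2 * (1 - s / 2) ^+ 2.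
apply: (integral_itv_poly
  (c := [:: C ^+ 2; 2 * B * C; B ^+ 2 + 2 * A * C; 2 * A * B; A ^+ 2])).
- by rewrite gerBl divr_ge0.
- by move=> u; rewrite !big_ord_recl big_ord0 /= /bump /= ?add1n /A /B /C; field.
- by rewrite !big_ord_recl big_ord0 /= /bump /= ?add1n /A /B /C; field.
Qed.

Lemma integral_sqr_cut_gap (h : R) : 0 <= h ->
  (\int[mu]_(s in `[0%R, (2 * h)%R])
     (h ^+ 2 * s ^+ 3 / 2 - 5 / 12 * h * s ^+ 4 + 7 / 80 * s ^+ 5)%:E
   = (4 / 15 * h ^+ 6)%:E)%E.
Proof.
move=> h0; apply: (integral_itv_poly
  (c := [:: 0; 0; 0; h ^+ 2 / 2; - (5 / 12 * h); 7 / 80])).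
- by rewrite mulr_ge0.
- by move=> u; rewrite !big_ord_recl big_ord0 /= /bump /= ?add1n; field.
- by rewrite !big_ord_recl big_ord0 /= /bump /= ?add1n; field.
Qed.

(** The difference of the lengths that [0, t] covers in the two cells is a tent: it rises to h at t
    = h, falls to 0 at 2h and stays there. *)
Lemma integral_sqr_tent (h : R) : 0 <= h -> 2 * h <= 1 ->
  (\int[mu]_(t in `[0%R, 1%R])
     ((Num.max 0 (Num.min h t) - Num.max 0 (Num.min (2 * h) t - h)) ^+ 2)%:E
   = (2 / 3 * h ^+ 3)%:E)%E.
Proof.
move=> h0 h1; 
pose f (t : R) := (Num.max 0 (Num.min h t) - Num.max 0 (Num.min (2 * h) t - h)) ^+ 2.
have mf : measurable_fun setT f.
  apply: measurable_funX; apply: measurable_funB.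
    by apply: measurable_maxr => //; exact: measurable_minr.
  apply: measurable_maxr => //; apply: measurable_funB => //.
  by apply: measurable_minr.
have f0 u : 0 <= f u by exact: sqr_ge0.
rewrite -/(f _) (@ge0_integral_itv_split f 0 h 1)//; last by apply/andP; split; lra.
rewrite (@ge0_integral_itv_split f h (2 * h) 1)//; last by apply/andP; split; lra.
rewrite (_ : 2 / 3 * h ^+ 3 = h ^+ 3 / 3 + (h ^+ 3 / 3 + 0)); last by field.
rewrite 2!EFinD; congr (_ + (_ + _))%E.
- transitivity (\int[mu]_(t in `[0%R, h]) (t ^+ 2)%:E)%E.
    apply: eq_integral => u; rewrite inE /= in_itv/= => /andP[u0 us].
    by rewrite /f (min_r us) (max_r u0) min_r ?max_l ?subr0//; lra.
  apply: (integral_itv_poly (c := [:: 0; 0; 1])) => //.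
  + by move=> u; rewrite !big_ord_recl big_ord0 /= /bump /= ?add1n; ring.
  + by rewrite !big_ord_recl big_ord0 /= /bump /= ?add1n; field.
- transitivity (\int[mu]_(t in `[h, (2 * h)%R]) ((2 * h - t) ^+ 2)%:E)%E.
    apply: eq_integral => u; rewrite inE /= in_itv/= => /andP[u0 us].
    rewrite /f (min_l u0) (max_r h0) (min_r us) max_r ?subr_ge0//.
    by congr (_%:E); ring.
  apply: (integral_itv_poly (c := [:: 4 * h ^+ 2; - (4 * h); 1])).
  + by lra.
  + by move=> u; rewrite !big_ord_recl big_ord0 /= /bump /= ?add1n; ring.
  + by rewrite !big_ord_recl big_ord0 /= /bump /= ?add1n; field.
- transitivity (\int[mu]_(t in `[(2 * h)%R, 1%R]) (0 : R)%:E)%E; last by rewrite integral0.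
  apply: eq_integral => u; rewrite inE /= in_itv/= => /andP[u0 us].
  rewrite /f min_l; last by lra.
  rewrite (max_r h0) (min_l u0) max_r; last by lra.
  by congr (_%:E); ring.
Qed.

End interval_integrals.

(** * The diagonal cut of two neighbouring cubes *)

Section cut_partition.
Context {R : realType}.
Variables n m : nat.
Notation mu := (@lebesgue_measure R).
Local Notation d := n.+2.
Local Notation h := (m.+2%:R^-1 : R).
Local Notation cell j := (@jitter_cell R d m.+2 j).
Implicit Types (x y : d.-tuple R) (t : R).

Definition box e (lo hi : 'I_e -> R) : set (e.-tuple R) :=
  [set z | forall k, lo k <= tnth z k <= hi k].

Let k1 : 'I_d := lift ord0 ord0.

Lemma width_gt0 : 0 < h. Proof. by rewrite invr_gt0. Qed.
Hint Resolve width_gt0 : core.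

Lemma width_le : 2 * h <= 1.
Proof. by rewrite ler_pdivrMr// mul1r ler_nat. Qed.

Lemma box_anchored e (lo hi : 'I_e -> R) (x : e.-tuple R) :
  (forall k, 0 <= lo k) ->
  box lo hi `&` anchored_box x = box lo (fun k => Num.min (hi k) (tnth x k)).
Proof.
move=> lo0; apply/seteqP; split => z /=.
  move=> [zb za] k; have /andP[z1 z2] := zb k; have /andP[_ z3] := za k.
  by rewrite z1 le_min z2.
move=> zb; split => k; have := zb k; rewrite le_min => /and3P[z1 z2 z3].
  by rewrite z1.
by rewrite z3 (le_trans (lo0 k)).
Qed.

Lemma vol_box_anchored e (lo hi : 'I_e -> R) (x : e.-tuple R) :
  (forall k, 0 <= lo k) ->
  vol (box lo hi `&` anchored_box x) =
  (\prod_(k < e) Num.max 0 (Num.min (hi k) (tnth x k) - lo k))%:E.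
Proof. by move=> lo0; rewrite box_anchored// vol_box. Qed.

Definition pair_lo (k : 'I_d) : R := if k == ord0 then 0 else 1 - h.
Definition pair_hi (k : 'I_d) : R := if k == ord0 then 2 * h else 1.
Definition pair_box : set (d.-tuple R) := box pair_lo pair_hi.

(** The equation is free of [h]: a diagonal descending from (0, 1) in a rectangle of width 2h and
    height h has slope -1/2 for every [h]. *)
Definition below_cut : set (d.-tuple R) :=
  [set y | tnth y ord0 / 2 + tnth y k1 <= 1].
Definition lower_piece := pair_box `&` below_cut.
Definition upper_piece := pair_box `\` below_cut.

Definition left_cell : {ffun 'I_d -> 'I_m.+2} :=
  [ffun k => if k == ord0 then ord0 else ord_max].
Definition right_cell : {ffun 'I_d -> 'I_m.+2} :=
  [ffun k => if k == ord0 then lift ord0 ord0 else ord_max].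

Definition cut_cell (j : {ffun 'I_d -> 'I_m.+2}) : set (d.-tuple R) :=
  if j == left_cell then lower_piece
  else if j == right_cell then upper_piece else cell j.

(** Length of the part of the grid interval number [i], counted from 0, that lies below [t]. *)
Definition cell_section (i : nat) t : R :=
  Num.max 0 (Num.min (i.+1%:R * h) t - i%:R * h).
Definition ramp t : R := Num.max 0 (Num.min 1 t - (1 - h)).

Lemma cell_section_max t : cell_section m.+1 t = ramp t.
Proof.
rewrite /cell_section /ramp divff ?pnatr_eq0//; congr (Num.max 0 (_ - _)).
by apply/eqP; rewrite eq_sym subr_eq -{2}[h]mul1r -mulrDl natr1 divff ?pnatr_eq0.
Qed.

Lemma vol_jitter_cell_anchored (j : {ffun 'I_d -> 'I_m.+2}) x :
  vol (cell j `&` anchored_box x) =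
  (\prod_k cell_section (j k) (tnth x k))%:E.
Proof. by apply: vol_box_anchored => k; rewrite divr_ge0. Qed.

Lemma vol_jitter_cell (j : {ffun 'I_d -> 'I_m.+2}) :
  vol (cell j) = (h ^+ d)%:E.
Proof.
rewrite [LHS](vol_box (fun k => (j k)%:R * h) (fun k => (j k).+1%:R * h)).
rewrite (eq_bigr (fun=> h)) ?prodr_const ?card_ord// => k _.
by rewrite -mulrBl -natr1 addrAC subrr add0r mul1r max_r// ltW.
Qed.

Lemma measurable_below_cut : measurable below_cut.
Proof.
rewrite [X in measurable X](_ : _ =
  [set y : d.-tuple R | 0 <= 1 - (tnth y ord0 / 2 + tnth y k1)]).
  apply: measurable_ge0_set; apply: measurable_funB => //.
  apply: measurable_funD; last exact: measurable_tnth.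
  by apply: measurable_funM => //; exact: measurable_tnth.
by apply/seteqP; split => y /=; rewrite subr_ge0.
Qed.

Lemma measurable_lower_piece : measurable lower_piece.
Proof. by apply: measurableI; [exact: measurable_box|exact: measurable_below_cut]. Qed.

Lemma measurable_upper_piece : measurable upper_piece.
Proof. by apply: measurableD; [exact: measurable_box|exact: measurable_below_cut]. Qed.

Lemma pair_lo_ge0 k : 0 <= pair_lo k.
Proof.
rewrite /pair_lo; case: ifP => // _.
by have := width_le; have := width_gt0; move: h => w ? ?; lra.
Qed.

Lemma cell_section_pair t :
  cell_section 0 t + cell_section 1 t = Num.max 0 (Num.min (2 * h) t - 0).
Proof.
rewrite /cell_section !mul1r mul0r !subr0; have := width_gt0; move: h => w w0.
case: (leP w t) => wt.
  rewrite (max_r (ltW w0)); have wm : w <= Num.min (2 * w) t.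
    by rewrite le_min wt andbT; lra.
  by rewrite !max_r ?subr_ge0 ?(le_trans (ltW w0) wm)// addrC subrK.
rewrite (@min_r _ _ (2 * w)); last by lra.
by rewrite [X in _ + X]max_l ?addr0// subr_le0 ltW.
Qed.

Lemma vol_pair_box_anchored x :
  vol (pair_box `&` anchored_box x) =
  (Num.max 0 (Num.min (2 * h) (tnth x ord0) - 0) *
   \prod_(k < n.+1) ramp (tnth x (lift ord0 k)))%:E.
Proof.
by rewrite vol_box_anchored ?big_ord_recl//; exact: pair_lo_ge0.
Qed.

Lemma vol_left_cell_anchored x :
  vol (cell left_cell `&` anchored_box x) =
  (cell_section 0 (tnth x ord0) * \prod_(k < n.+1) ramp (tnth x (lift ord0 k)))%:E.
Proof.
rewrite vol_jitter_cell_anchored /left_cell [in LHS]big_ord_recl ffunE eqxx; congr (_ * _)%:E.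
by apply: eq_bigr => k _; rewrite ffunE -cell_section_max.
Qed.

Lemma vol_right_cell_anchored x :
  vol (cell right_cell `&` anchored_box x) =
  (cell_section 1 (tnth x ord0) * \prod_(k < n.+1) ramp (tnth x (lift ord0 k)))%:E.
Proof.
rewrite vol_jitter_cell_anchored /right_cell [in LHS]big_ord_recl ffunE eqxx; congr (_ * _)%:E.
by apply: eq_bigr => k _; rewrite ffunE -cell_section_max.
Qed.

(** Yields the upper piece by subtraction, so that only the lower piece requires an integration. *)
Lemma vol_pieces_anchored x :
  (vol (lower_piece `&` anchored_box x) + vol (upper_piece `&` anchored_box x)
   = vol (pair_box `&` anchored_box x))%E.
Proof.
have -> : lower_piece `&` anchored_box x = (pair_box `&` anchored_box x) `&` below_cut.
  by apply/seteqP; split => y [[]].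
have -> : upper_piece `&` anchored_box x = (pair_box `&` anchored_box x) `\` below_cut.
  by apply/seteqP; split => y [[]].
apply/esym; apply: volUD; last exact: measurable_below_cut.
by apply: measurableI; [exact: measurable_box|exact: measurable_anchored_box].
Qed.

(** Slicing along coordinate 0 turns the piece into boxes, since the cut involves only one further
    coordinate. *)
Lemma vol_lower_piece_anchored x :
  0 <= tnth x ord0 <= 2 * h -> 1 - h <= tnth x k1 <= 1 ->
  1 <= tnth x ord0 / 2 + tnth x k1 ->
  vol (lower_piece `&` anchored_box x) =
  ((tnth x ord0 * (tnth x k1 - (1 - h)) - (tnth x ord0 / 2 + tnth x k1 - 1) ^+ 2)
   * \prod_(k < n) ramp (tnth x (lift ord0 (lift ord0 k))))%:E.
Proof.
set s := tnth x ord0; set y := tnth x k1 => /andP[s0 sh] /andP[hy y1] sy.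
set P := \prod_(k < n) _.
have P0 : 0 <= P by apply: prodr_ge0 => k _; rewrite le_max lexx.
have hw := width_le; have w0 := width_gt0.
set F := fun u : R => \1_[set` `[0, s]] u * Num.max 0 (Num.min y (1 - u / 2) - (1 - h)).
have F0 u : 0 <= F u by rewrite mulr_ge0// le_max lexx.
have mF : measurable_fun [set: R] (fun u => (F u)%:E).
  apply/measurable_EFinP; apply: measurable_funM; first exact: measurable_indic.
  apply: measurable_maxr => //; apply: measurable_funB => //.
  apply: measurable_minr => //; apply: measurable_funB => //.
  by apply: measurable_funM => //; exact: measurable_id.
have slice_int (u : R) : leb_int (fun z : n.+1.-tuple R =>
    (\1_(lower_piece `&` anchored_box x) [tuple of u :: z])%:E) = ((F u)%:E * P%:E)%E.
  (* At first coordinate [u] the cut amounts to the extra upper bound 1 - u/2 on the second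
     coordinate. *)
  pose hi (k : 'I_n.+1) : R :=
    if k == ord0 then Num.min y (1 - u / 2) else Num.min 1 (tnth x (lift ord0 k)).
  have slice (z : n.+1.-tuple R) : (lower_piece `&` anchored_box x) [tuple of u :: z] <->
      0 <= u <= s /\ box (fun=> 1 - h) hi z.
    split.
      move=> [[zb zc] za]; have := zb ord0; have := za ord0.
      rewrite tnth0 -/s => /andP[u0 us] _; split; first by rewrite u0.
      move=> k; have := zb (lift ord0 k); have := za (lift ord0 k).
      rewrite tnthS /pair_lo /pair_hi /= => /andP[z0 zx] /andP[-> z1] /=.
      rewrite /hi; case: eqP => k0; last by rewrite le_min z1.
      move: zc zx; rewrite /below_cut /= /k1 tnth0 tnthS k0 -/k1 -/y => zc zx.
      by rewrite le_min zx /=; lra.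
    move=> [/andP[u0 us] zb]; split; [split|].
    - move=> k; case: (unliftP ord0 k) => [k' ->|->].
        rewrite tnthS /pair_lo /pair_hi /=; have /andP[-> /=] := zb k'.
        by rewrite /hi; case: eqP => _; rewrite le_min => /andP[]; lra.
      by rewrite tnth0 /pair_lo /pair_hi eqxx u0 (le_trans us).
    - rewrite /below_cut /= /k1 tnth0 tnthS.
      have /andP[_] := zb ord0; rewrite /hi eqxx le_min => /andP[_]; lra.
    - move=> k; case: (unliftP ord0 k) => [k' ->|->]; last by rewrite tnth0 u0.
      rewrite tnthS; have /andP[z0] := zb k'; rewrite (le_trans (pair_lo_ge0 k1))//=.
      rewrite /hi; case: eqP => [->|_]; rewrite le_min => /andP[]//.
  case: (boolP (0 <= u <= s)) => us.
    transitivity (vol (box (fun=> 1 - h) hi)).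
      apply: eq_leb_int => z; congr (_%:E); rewrite !indicE; congr ((nat_of_bool _)%:R).
      by apply/idP/idP; rewrite !inE slice => // -[].
    rewrite vol_box big_ord_recl /F indicE mem_set/= ?in_itv// mul1r -EFinM.
    by congr (_ * _)%:E; rewrite /hi eqxx.
  have -> : F u = 0 by rewrite /F indicE memNset ?mul0r//= in_itv/=; exact/negP.
  rewrite mul0e.
  transitivity (leb_int (fun z : n.+1.-tuple R => 0%E : \bar R)).
    apply: eq_leb_int => z; rewrite indicE memNset// slice => -[us' _].
    by rewrite us' in us.
  exact: leb_int0.
rewrite EFinM -(integral_cut_strip sh) ?hy// -integral_indic_mul.
rewrite -ge0_integralZr//; last by move=> u _; rewrite lee_fin; exact: F0.
transitivity (\int[mu]_u leb_int (fun z : n.+1.-tuple R =>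
  (\1_(lower_piece `&` anchored_box x) [tuple of u :: z])%:E))%E => //.
by apply: eq_integral => u _; exact: slice_int.
Qed.


Lemma prod_ramp1 : \prod_(k < n) ramp 1 = h ^+ n.
Proof.
rewrite (eq_bigr (fun=> h)) ?prodr_const ?card_ord// => k _.
by rewrite /ramp minxx opprB addrC subrK max_r// ltW.
Qed.

(** The upper corner of [pair_box]: its anchored box contains [pair_box], so total volumes are
    instances of the anchored formulas. *)
Let corner : d.-tuple R := [tuple if k == ord0 then 2 * h else 1 | k < d].

Lemma pieces_sub_corner (A : set (d.-tuple R)) : A `<=` pair_box -> A `&` anchored_box corner = A.
Proof.
move=> AB; apply: setIidl => y /AB yB k; have := yB k.
rewrite tnth_mktuple /pair_hi => /andP[y0 ->].
by rewrite (le_trans (pair_lo_ge0 k) y0).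
Qed.

Lemma vol_pair_box : vol pair_box = (2 * h ^+ d)%:E.
Proof.
rewrite -[pair_box]pieces_sub_corner// vol_pair_box_anchored tnth_mktuple eqxx.
rewrite minxx subr0 max_r ?mulr_ge0// ?ltW//; congr (_%:E).
rewrite (eq_bigr (fun=> h)) ?prodr_const ?card_ord -?mulrA -?exprS// => k _.
by rewrite tnth_mktuple /= /ramp minxx opprB addrC subrK max_r// ltW.
Qed.

Lemma vol_lower_piece : vol lower_piece = (h ^+ d)%:E.
Proof.
rewrite -[lower_piece]pieces_sub_corner; last exact: subIsetl.
have c0 : tnth corner ord0 = 2 * h by rewrite tnth_mktuple eqxx.
have c1 : tnth corner k1 = 1 by rewrite tnth_mktuple.
have w0 := width_gt0.
rewrite vol_lower_piece_anchored ?c0 ?c1.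
- rewrite (eq_bigr (fun=> ramp 1)) ?prod_ramp1 => [|k _]; last by rewrite tnth_mktuple.
  by congr (_%:E); rewrite [h ^+ d]exprS [h ^+ n.+1]exprS; move: (h ^+ n) h => a w; field.
- by rewrite lexx mulr_ge0// ltW.
- by rewrite lexx andbT gerBl ltW.
- by move: h w0 => w w0; lra.
Qed.

Lemma vol_upper_piece : vol upper_piece = (h ^+ d)%:E.
Proof.
have := vol_pieces_anchored corner.
rewrite (pieces_sub_corner (@subIsetl _ pair_box below_cut)).
rewrite (pieces_sub_corner (@subDsetl _ pair_box below_cut)).
rewrite (pieces_sub_corner (@subset_refl _ pair_box)).
rewrite vol_lower_piece vol_pair_box; case: (vol upper_piece) => [r| |]//.
by rewrite -EFinD => -[] /eqP; rewrite mulrDl !mul1r (inj_eq (addrI _)) => /eqP ->.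
Qed.

Lemma vol_cut_cell j : vol (cut_cell j) = (h ^+ d)%:E.
Proof.
rewrite /cut_cell; case: ifP => _; first exact: vol_lower_piece.
by case: ifP => _; [exact: vol_upper_piece|exact: vol_jitter_cell].
Qed.

Lemma measurable_jitter_cell j : measurable (cell j).
Proof. exact: measurable_box. Qed.

Lemma measurable_cut_cell j : measurable (cut_cell j).
Proof.
rewrite /cut_cell; case: ifP => _; first exact: measurable_lower_piece.
by case: ifP => _; [exact: measurable_upper_piece|exact: measurable_jitter_cell].
Qed.

Lemma volume_exp_finite_positive (A : set (d.-tuple R)) : measurable A -> vol A = (h ^+ d)%:E ->
  finite_positive_volume A.
Proof. by move=> mA vA; split => //; rewrite vA ltry lte_fin exprn_gt0. Qed.

Lemma finite_positive_jitter_cell j : finite_positive_volume (cell j).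
Proof.
by apply: volume_exp_finite_positive; [exact: measurable_jitter_cell|exact: vol_jitter_cell].
Qed.

Lemma finite_positive_cut_cell j : finite_positive_volume (cut_cell j).
Proof.
by apply: volume_exp_finite_positive; [exact: measurable_cut_cell|exact: vol_cut_cell].
Qed.

Lemma left_neq_right : left_cell != right_cell.
Proof.
apply/eqP => /ffunP /(_ ord0); rewrite !ffunE eqxx.
by move=> /(congr1 val).
Qed.

Lemma cut_cell_left : cut_cell left_cell = lower_piece.
Proof. by rewrite /cut_cell eqxx. Qed.

Lemma cut_cell_right : cut_cell right_cell = upper_piece.
Proof. by rewrite /cut_cell eq_sym (negbTE left_neq_right) eqxx. Qed.

Lemma fine_vol_pieces_anchored x :
  fine (vol (lower_piece `&` anchored_box x)) + fine (vol (upper_piece `&` anchored_box x)) =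
  Num.max 0 (Num.min (2 * h) (tnth x ord0) - 0) *
   \prod_(k < n.+1) ramp (tnth x (lift ord0 k)).
Proof.
have mb := measurable_anchored_box x.
have fl : vol (lower_piece `&` anchored_box x) \is a fin_num.
  apply: (@vol_sub_fin _ _ lower_piece); last exact: subIsetl.
  - by rewrite -cut_cell_left; exact: finite_positive_cut_cell.
  - by apply: measurableI => //; exact: measurable_lower_piece.
have fu : vol (upper_piece `&` anchored_box x) \is a fin_num.
  apply: (@vol_sub_fin _ _ upper_piece); last exact: subIsetl.
  - by rewrite -cut_cell_right; exact: finite_positive_cut_cell.
  - by apply: measurableI => //; exact: measurable_upper_piece.
rewrite -(fineD fl fu).
exact: (congr1 fine (etrans (vol_pieces_anchored x) (vol_pair_box_anchored x))).
Qed.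

Lemma box_prob_lower_piece x :
  box_prob lower_piece x = fine (vol (lower_piece `&` anchored_box x)) / h ^+ d.
Proof. exact: (congr1 (fun v => _ / fine v) vol_lower_piece). Qed.

Lemma box_prob_upper_piece x :
  box_prob upper_piece x = fine (vol (upper_piece `&` anchored_box x)) / h ^+ d.
Proof. exact: (congr1 (fun v => _ / fine v) vol_upper_piece). Qed.

Lemma box_prob_jitter_cell j x :
  box_prob (cell j) x = fine (vol (cell j `&` anchored_box x)) / h ^+ d.
Proof. exact: (congr1 (fun v => _ / fine v) (vol_jitter_cell j)). Qed.

Lemma box_prob_pieces x :
  box_prob lower_piece x + box_prob upper_piece x =
  box_prob (cell left_cell) x + box_prob (cell right_cell) x.
Proof.
rewrite box_prob_lower_piece box_prob_upper_piece.
rewrite (box_prob_jitter_cell left_cell) (box_prob_jitter_cell right_cell).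
rewrite -[LHS]mulrDl -[RHS]mulrDl; apply: (congr1 (fun u => u / h ^+ d)).
apply: (etrans (fine_vol_pieces_anchored x)).
by rewrite vol_left_cell_anchored vol_right_cell_anchored /= -mulrDl cell_section_pair.
Qed.

Lemma box_prob_cells_gap x :
  box_prob (cell left_cell) x - box_prob (cell right_cell) x =
  (cell_section 0 (tnth x ord0) - cell_section 1 (tnth x ord0)) *
  \prod_(k < n.+1) ramp (tnth x (lift ord0 k)) / h ^+ d.
Proof.
rewrite (box_prob_jitter_cell left_cell) (box_prob_jitter_cell right_cell).
rewrite vol_left_cell_anchored vol_right_cell_anchored /=.
by rewrite -[LHS]mulrBl -[X in X / _ = _]mulrBl.
Qed.

(** Lower minus upper is twice lower minus total, which doubles the triangle term of the lower
    area. *)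
Lemma box_prob_pieces_gap x :
  0 <= tnth x ord0 <= 2 * h -> 1 - tnth x ord0 / 2 <= tnth x k1 <= 1 ->
  box_prob lower_piece x - box_prob upper_piece x =
  (tnth x ord0 * (tnth x k1 - (1 - h)) - 2 * (tnth x ord0 / 2 + tnth x k1 - 1) ^+ 2)
  * \prod_(k < n) ramp (tnth x (lift ord0 (lift ord0 k))) / h ^+ d.
Proof.
move=> s01 /andP[sy y1]; have /andP[s0 sh] := s01.
have hy : 1 - h <= tnth x k1 by move: h sh => w sh; lra.
rewrite box_prob_lower_piece box_prob_upper_piece.
rewrite -[LHS]mulrBl.
apply: (congr1 (fun u => u / h ^+ d)); have := fine_vol_pieces_anchored x.
rewrite vol_lower_piece_anchored ?hy//=; last by lra.
rewrite min_r// subr0 max_r// big_ord_recl -/k1.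
rewrite [ramp (tnth x k1)]/ramp min_r// max_r ?subr_ge0//.
move: (fine _) (\prod_(k < n) _) (tnth x ord0) (tnth x k1) (1 - h) => u P s y b E.
have -> : u = s * ((y - b) * P) - (s * (y - b) - (s / 2 + y - 1) ^+ 2) * P.
  by rewrite -E [X in X - _]addrC addrK.
ring.
Qed.

End cut_partition.

(** * Comparison of the gap integrals of the cubes and of the pieces *)

Section gap_comparison.
Context {R : realType}.
Variables n m : nat.
Notation mu := (@lebesgue_measure R).
Local Notation d := n.+2.
Local Notation h := (m.+2%:R^-1 : R).
Local Notation I := {ffun 'I_d -> 'I_m.+2}.
Local Notation D s y :=
  (s * (y - (1 - h)) - 2 * (s / 2 + y - 1) ^+ 2).

Let scale : R := ((h ^+ d) ^+ 2 * (2 * #|I|%:R ^+ 2))^-1.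
(** Factor of the squared gap due to a coordinate in which both cells occupy the last interval. *)
Let slab (t : R) : R := \1_[set` `[0%R, 1%R]] t * ramp m t ^+ 2.

Let card_gt0 : 0 < #|I|%:R :> R.
Proof. by rewrite ltr0n; apply/card_gt0P; exists (left_cell n m). Qed.

Let scale_gt0 : 0 < scale.
Proof.
have h0 : 0 < h by exact: width_gt0.
rewrite invr_gt0; apply: mulr_gt0; first by do 2 apply: exprn_gt0.
by apply: mulr_gt0 => //; exact: exprn_gt0.
Qed.

Let slab_ge0 t : 0 <= slab t.
Proof. by rewrite mulr_ge0// sqr_ge0. Qed.

Let measurable_slab : measurable_fun setT slab.
Proof.
apply: measurable_funM; first exact: measurable_indic.
apply: measurable_funX; apply: measurable_maxr => //.
by apply: measurable_funB => //; exact: measurable_minr.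
Qed.

Lemma integral_ge0Z_EFin (k v : R) (f : R -> R) : 0 <= k ->
  measurable_fun setT f -> (forall u, 0 <= f u) ->
  (\int[mu]_u (f u)%:E = v%:E)%E -> (\int[mu]_u (k * f u)%:E = (k * v)%:E)%E.
Proof.
move=> k0 mf f0 fv; rewrite EFinM -fv -ge0_integralZl//.
- exact/measurable_EFinP.
- by move=> u _; rewrite lee_fin.
Qed.

Lemma integral_slab : (\int[mu]_t (slab t)%:E = (h ^+ 3 / 3)%:E)%E.
Proof.
have w0 := @width_gt0 R m; have w1 := @width_le R m.
rewrite -(integral_sqr_ramp (ltW w0)) -integral_indic_mul.
apply: eq_integral => t _; congr (_%:E); rewrite /slab /ramp.
rewrite !indicE !mem_setE !in_itv/=; move: h w0 w1 => w w0 w1.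
case: (leP t 1) => t1; rewrite ?andbF ?mul0r// !andbT.
case: (leP (1 - w) t) => wt.
  by rewrite (_ : 0 <= t) ?max_r ?mul1r//; lra.
by rewrite mul0r max_l ?expr0n ?mulr0// subr_le0 ltW.
Qed.

Lemma indic_unit_cubeE (x : d.-tuple R) :
  \1_(@unit_cube R d) x = \prod_(k < d) \1_[set` `[0%R, 1%R]] (tnth x k) :> R.
Proof. exact: (indic_box (fun=> 0) (fun=> 1)). Qed.

Lemma stratum_gapE (Om : I -> set (d.-tuple R)) i j x (u : R) :
  box_prob (Om i) x - box_prob (Om j) x = u / h ^+ d ->
  stratum_gap Om i j x = scale * (\1_(unit_cube d) x * u ^+ 2).
Proof.
move=> uE; rewrite /stratum_gap uE /scale.
have := card_gt0; have : 0 < h ^+ d by rewrite exprn_gt0// width_gt0.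
move: (h ^+ d) (#|I|%:R : R) => v N /lt0r_neq0 v0 /lt0r_neq0 N0.
by field; rewrite N0.
Qed.

Lemma prod_slab e (F : 'I_e -> R) : \prod_(k < e) slab (F k) =
  \prod_(k < e) \1_[set` `[0%R, 1%R]] (F k) * (\prod_(k < e) ramp m (F k)) ^+ 2.
Proof. by rewrite -prodrXl -big_split. Qed.

(** For the cubes the squared gap splits over the coordinates: a squared tent in coordinate 0 and a
    slab in each other one. *)
Lemma leb_int_cells_gap :
  leb_int (fun x => (stratum_gap (fun j : I => jitter_cell j)
                       (left_cell n m) (right_cell n m) x)%:E) =
  (scale * (2 / 3 * h ^+ 3 * (h ^+ 3 / 3) ^+ n.+1))%:E.
Proof.
pose tent (t : R) : R := \1_[set` `[0%R, 1%R]] t * (cell_section m 0 t - cell_section m 1 t) ^+ 2.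
have tent0 t : 0 <= tent t by rewrite mulr_ge0// sqr_ge0.
have msec i : measurable_fun [set: R] (cell_section m i).
  apply: measurable_maxr => //; apply: measurable_funB => //.
  exact: measurable_minr.
have mtent : measurable_fun [set: R] tent.
  apply: measurable_funM; first exact: measurable_indic.
  by apply: measurable_funX; exact: measurable_funB.
have itent : (\int[mu]_t (tent t)%:E = (2 / 3 * h ^+ 3)%:E)%E.
  rewrite integral_indic_mul -(integral_sqr_tent (ltW (width_gt0 m)) (width_le m)).
  apply: eq_integral => t _; congr (_%:E).
  by rewrite /cell_section mul1r mul0r subr0.
pose f (k : 'I_d) : R -> R := if k == ord0 then tent else slab.
transitivity (leb_int (fun x : d.-tuple R => scale%:E * (\prod_(k < d) f k (tnth x k))%:E))%E.
  apply: eq_leb_int => x; rewrite -EFinM; congr (_%:E).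
  rewrite (stratum_gapE (box_prob_cells_gap m x)) indic_unit_cubeE [in RHS]big_ord_recl.
  have -> : \prod_(i < n.+1) f (lift ord0 i) (tnth x (lift ord0 i)) = _ :=
    prod_slab (fun k => tnth x (lift ord0 k)).
  by rewrite [X in scale * (X * _) = _]big_ord_recl /f /= /tent; ring.
rewrite ge0_leb_intZl; first last.
- by rewrite lee_fin ltW.
- by move=> x; rewrite lee_fin prodr_ge0// => k _; rewrite /f; case: ifP.
- apply/measurable_EFinP; apply: measurable_prod => k _.
  apply: (measurableT_comp (f := f k)); last exact: measurable_tnth.
  by rewrite /f; case: ifP.
rewrite (leb_int_prod (f := f)
  (c := fun k => if k == ord0 then 2 / 3 * h ^+ 3 else h ^+ 3 / 3)); first last.
- by move=> k; rewrite /f; case: ifP => _; [exact: itent|exact: integral_slab].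
- by move=> k t; rewrite /f; case: ifP.
- by move=> k; rewrite /f; case: ifP.
by rewrite big_ord_recl /= prodr_const card_ord EFinM.
Qed.

Let trapezoid (s : R) : R := \1_[set` `[0%R, (2 * h)%R]] s.
Let top_strip (s y : R) : R := \1_[set` `[(1 - s / 2)%R, 1%R]] y.

(** Squared gap of the pieces, set to 0 outside the region above the cut where its formula is
    polynomial. Coordinates 0 and 1 are coupled here, so they are integrated successively; only the
    remaining ones split off as slabs. *)
Let witness (x : d.-tuple R) : R :=
  trapezoid (tnth x ord0)
  * (top_strip (tnth x ord0) (tnth x (lift ord0 ord0))
     * D (tnth x ord0) (tnth x (lift ord0 ord0)) ^+ 2)
  * \prod_(k < n) slab (tnth x (lift ord0 (lift ord0 k))).

Let witness_ge0 x : 0 <= witness x.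
Proof.
apply: mulr_ge0; last exact: prodr_ge0.
by apply: mulr_ge0 => //; apply: mulr_ge0 => //; exact: sqr_ge0.
Qed.

Let measurable_witness : measurable_fun setT witness.
Proof.
have m0 : measurable_fun setT (fun x : d.-tuple R => tnth x ord0).
  exact: measurable_tnth.
have m1 : measurable_fun setT (fun x : d.-tuple R => tnth x (lift ord0 ord0)).
  exact: measurable_tnth.
have mh : measurable_fun setT (fun x : d.-tuple R => tnth x ord0 / 2).
  exact: measurable_funM.
apply: measurable_funM; last first.
  apply: measurable_prod => k _; apply: (measurableT_comp measurable_slab).
  exact: measurable_tnth.
apply: measurable_funM.
  have mi : measurable_fun [set: R] trapezoid by exact: measurable_indic.
  exact: (measurableT_comp mi).
apply: measurable_funM; last first.
  apply: measurable_funX; apply: measurable_funB.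
    by apply: measurable_funM => //; exact: measurable_funB.
  apply: measurable_funM => //; apply: measurable_funX.
  by apply: measurable_funB => //; exact: measurable_funD.
(* The bounds of the strip vary with coordinate 0, so its indicator is recognized as that of a set
   of tuples. *)
pose S := [set x : d.-tuple R | 0 <= tnth x (lift ord0 ord0) - (1 - tnth x ord0 / 2)]
  `&` [set x : d.-tuple R | 0 <= 1 - tnth x (lift ord0 ord0)].
rewrite [X in measurable_fun _ X](_ : _ = \1_S).
  apply: measurable_indic; apply: measurableI; apply: measurable_ge0_set.
    by apply: measurable_funB => //; exact: measurable_funB.
  exact: measurable_funB.
apply/funext => x; rewrite /top_strip !indicE; congr ((nat_of_bool _)%:R).
rewrite mem_setE in_itv/=; apply/idP/idP; rewrite inE /S /= !subr_ge0 => /andP//.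
Qed.

Let witness_le (x : d.-tuple R) :
  scale * witness x <=
  stratum_gap (@cut_cell R n m) (left_cell n m) (right_cell n m) x.
Proof.
case: (boolP (0 <= tnth x ord0 <= 2 * h)) => s01; last first.
  rewrite /witness /trapezoid indicE mem_setE in_itv/= (negbTE s01) !mul0r mulr0.
  exact: stratum_gap_ge0.
case: (boolP (1 - tnth x ord0 / 2 <= tnth x (lift ord0 ord0) <= 1)) => y01; last first.
  rewrite /witness /top_strip [\1__ (tnth x (lift ord0 ord0))]indicE mem_setE in_itv/=.
  by rewrite (negbTE y01) !(mul0r, mulr0) stratum_gap_ge0.
have := box_prob_pieces_gap s01 y01.
rewrite -cut_cell_left -cut_cell_right => /stratum_gapE ->.
rewrite ler_pM2l// indic_unit_cubeE 2!big_ord_recl /witness.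
rewrite (prod_slab (fun k => tnth x (lift ord0 (lift ord0 k)))).
have /andP[s0 sh] := s01; have /andP[sy y1] := y01; have hw := @width_le R m.
rewrite /trapezoid /top_strip !indicE !mem_setE !in_itv/= s01 y01 s0 y1.
have -> : tnth x ord0 <= 1 by exact: le_trans hw.
have -> : 0 <= tnth x (lift ord0 ord0).
  by move: h sh hw => w sh hw; lra.
by rewrite le_eqVlt; apply/orP; left; apply/eqP; ring.
Qed.

Let leb_int_witness :
  leb_int (fun x => (scale * witness x)%:E) =
  (scale * (4 / 15 * h ^+ 6 * (h ^+ 3 / 3) ^+ n))%:E.
Proof.
pose c := scale * (h ^+ 3 / 3) ^+ n.
have h0 : 0 < h := width_gt0 m.
have c0 : 0 <= c by rewrite mulr_ge0 ?ltW// exprn_gt0 ?divr_gt0 ?exprn_gt0.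
have inner (s y : R) : leb_int (fun z : n.-tuple R =>
    (scale * witness [tuple of s :: [tuple of y :: z]])%:E) =
    (c * trapezoid s * (top_strip s y * D s y ^+ 2))%:E.
  pose a := scale * trapezoid s * (top_strip s y * D s y ^+ 2).
  have a0 : 0 <= a.
    apply: mulr_ge0; first by apply: mulr_ge0 => //; exact: ltW.
    by apply: mulr_ge0 => //; exact: sqr_ge0.
  transitivity (leb_int (fun z : n.-tuple R => a%:E * (\prod_(k < n) slab (tnth z k))%:E))%E.
    apply: eq_leb_int => z; rewrite -EFinM /witness !tnthS !tnth0; congr (_%:E).
    under eq_bigr do rewrite !tnthS.
    by rewrite /a !mulrA.
  rewrite ge0_leb_intZl//; last 2 first.
  - apply/measurable_EFinP; apply: measurable_prod => k _.
    by apply: (measurableT_comp measurable_slab); exact: measurable_tnth.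
  - by move=> z; rewrite lee_fin prodr_ge0.
  rewrite (leb_int_prod (f := fun=> slab) (c := fun=> h ^+ 3 / 3))//; last first.
    by move=> k; exact: integral_slab.
  by rewrite prodr_const card_ord -EFinM; congr (_%:E); rewrite /a /c; ring.
pose Q s := h ^+ 2 * s ^+ 3 / 2 - 5 / 12 * h * s ^+ 4 + 7 / 80 * s ^+ 5.
have mD (s : R) : measurable_fun [set: R] (fun y => D s y ^+ 2).
  apply: measurable_funX; apply: measurable_funB.
    by apply: measurable_funM => //; exact: measurable_funB.
  apply: measurable_funM => //; apply: measurable_funX.
  by apply: measurable_funB => //; exact: measurable_funD.
have middle (s : R) : (\int[mu]_y (c * trapezoid s * (top_strip s y * D s y ^+ 2))%:E
    = (c * (trapezoid s * Q s))%:E)%E.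
  rewrite mulrA; case: (boolP (0 <= s <= 2 * h)) => s01; last first.
    have -> : trapezoid s = 0 by rewrite /trapezoid indicE mem_setE in_itv/= (negbTE s01).
    rewrite mulr0 mul0r; under eq_integral do rewrite mul0r.
    exact: integral0.
  apply: integral_ge0Z_EFin.
  - by rewrite mulr_ge0.
  - by apply: measurable_funM => //; exact: measurable_indic.
  - by move=> y; rewrite mulr_ge0// sqr_ge0.
  - rewrite integral_indic_mul integral_sqr_cut_gap_inner//.
    by have /andP[] := s01.
transitivity (\int[mu]_s \int[mu]_y leb_int (fun z : n.-tuple R =>
    (scale * witness [tuple of s :: [tuple of y :: z]])%:E))%E => //.
transitivity (\int[mu]_s (c * (trapezoid s * Q s))%:E)%E.
  by apply: eq_integral => s _; rewrite -middle; apply: eq_integral => y _; exact: inner.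
rewrite (@integral_ge0Z_EFin _ (4 / 15 * h ^+ 6))//.
- by congr (_%:E); rewrite /c; ring.
- apply: measurable_funM; first exact: measurable_indic.
  apply: measurable_funD; first apply: measurable_funB.
  + by apply: measurable_funM => //; apply: measurable_funM => //; exact: measurable_funX.
  + by apply: measurable_funM => //; exact: measurable_funX.
  + by apply: measurable_funM => //; exact: measurable_funX.
- move=> s; rewrite /trapezoid indicE mem_setE in_itv/=.
  case: (boolP (0 <= s <= 2 * h)) => s01; last by rewrite mul0r.
  (* [Q s] is nonnegative because it is the integral of a square, so its sign needs no study of the
     polynomial. *)
  rewrite mul1r -lee_fin -integral_sqr_cut_gap_inner; last by have /andP[] := s01.
  by apply: integral_ge0 => y _; rewrite lee_fin sqr_ge0.
- by rewrite integral_indic_mul integral_sqr_cut_gap// ltW.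
Qed.

Lemma leb_int_gap_lt :
  (leb_int (fun x => (stratum_gap (fun j : I => jitter_cell j)
                       (left_cell n m) (right_cell n m) x : R)%:E)
   < leb_int (fun x => (stratum_gap (@cut_cell R n m)
                       (left_cell n m) (right_cell n m) x)%:E))%E.
Proof.
apply: (@lt_le_trans _ _ (leb_int (fun x => (scale * witness x)%:E))).
  rewrite leb_int_cells_gap leb_int_witness lte_fin ltr_pM2l//.
  have h0 : 0 < h := width_gt0 m.
  (* The slab of coordinate 1 is split off to face the coupled pair of coordinates of [witness];
     what remains is 2/9 < 4/15. *)
  rewrite [_ ^+ n.+1]exprS mulrA ltr_pM2r; last by rewrite exprn_gt0 ?divr_gt0 ?exprn_gt0.
  rewrite (_ : 2 / 3 * h ^+ 3 * (h ^+ 3 / 3) = 2 / 9 * h ^+ 6); last by field.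
  by rewrite ltr_pM2r ?exprn_gt0//; lra.
apply: ge0_le_leb_int.
- by apply/measurable_EFinP; apply: measurable_funM.
- apply/measurable_EFinP; apply: measurable_stratum_gap => j.
  exact: measurable_cut_cell.
- by move=> x; rewrite lee_fin mulr_ge0// ltW.
- by move=> x; rewrite lee_fin.
Qed.

End gap_comparison.

(** * The cut cells are convex, cover the cube and have disjoint interiors *)

Section cut_cells_partition_cube.
Context {R : realType}.
Variables n m : nat.
Local Notation d := n.+2.
Local Notation h := (m.+2%:R^-1 : R).
Local Notation I := {ffun 'I_d -> 'I_m.+2}.
Implicit Types (j : I) (x y : d.-tuple R).

Lemma convex_box e (lo hi : 'I_e -> R) : Defs.convex_set (box lo hi).
Proof.
move=> x y xb yb t /andP[t0 t1] k; rewrite tnth_mktuple.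
have /andP[x1 x2] := xb k; have /andP[y1 y2] := yb k.
by move: (tnth x k) (tnth y k) (lo k) (hi k) x1 x2 y1 y2 => a b l u *; nra.
Qed.

Lemma convex_setI e (A B : set (e.-tuple R)) :
  Defs.convex_set A -> Defs.convex_set B -> Defs.convex_set (A `&` B).
Proof.
by move=> cA cB x y [xA xB] [yA yB] t t01; split; [exact: cA|exact: cB].
Qed.

Lemma convex_below_cut : Defs.convex_set (@below_cut R n).
Proof.
move=> x y; rewrite /below_cut /= => xb yb t /andP[t0 t1]; rewrite !tnth_mktuple.
move: xb yb; move: (tnth x _) (tnth x _) (tnth y _) (tnth y _) => a b u v xb yb; nra.
Qed.

Lemma convex_above_cut : Defs.convex_set (~` (@below_cut R n)).
Proof.
move=> x y; rewrite /below_cut /= => /negP + /negP; rewrite -!ltNge => xb yb t.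
move=> /andP[t0 t1]; apply/negP; rewrite -ltNge !tnth_mktuple.
move: xb yb; move: (tnth x _) (tnth x _) (tnth y _) (tnth y _) => a b u v xb yb.
(* The half-space is open: for positive [t] strictness comes from [x], while at [t = 0] it has to
   come from [y]. *)
have [->|tp] := eqVneq t 0; first by lra.
have : 0 < t by rewrite lt_neqAle eq_sym tp.
by move=> ?; nra.
Qed.

Lemma convex_cut_cell j : Defs.convex_set (cut_cell (R := R) j).
Proof.
rewrite /cut_cell; case: ifP => _.
  by apply: convex_setI; [exact: convex_box|exact: convex_below_cut].
case: ifP => _; last exact: convex_box.
by apply: convex_setI; [exact: convex_box|exact: convex_above_cut].
Qed.

(** The number of intervals is decoupled from their width [h], so that it can vary in the
    induction. *)
Lemma grid_cell_exists (N : nat) (t : R) : 0 <= t <= N.+1%:R * h ->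
  exists i : 'I_N.+1, i%:R * h <= t <= i.+1%:R * h.
Proof.
elim: N => [|N IH] /andP[t0 tN]; first by exists ord0; rewrite mul0r t0.
case: (leP t (N.+1%:R * h)) => tN1.
  have [i ti] : exists i : 'I_N.+1, i%:R * h <= t <= i.+1%:R * h by apply: IH; rewrite t0.
  by exists (widen_ord (leqnSn _) i).
by exists ord_max; rewrite tN ltW.
Qed.

Lemma jitter_cells_cover x : unit_cube d x -> exists j, jitter_cell j x.
Proof.
move=> xc.
have /fin_all_exists[f fP] (k : 'I_d) : exists i : 'I_m.+2,
    i%:R * h <= tnth x k <= i.+1%:R * h.
  by apply: grid_cell_exists; rewrite divff ?pnatr_eq0//; exact: xc.
by exists [ffun k => f k] => k; rewrite ffunE.
Qed.

Lemma left_right_cell_sub j x : j = left_cell n m \/ j = right_cell n m ->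
  jitter_cell j x -> pair_box m x.
Proof.
have w0 := @width_gt0 R m.
move=> jE xj k; have := xj k; rewrite /pair_lo /pair_hi.
have -> : nat_of_ord (j k) = if k == ord0 then nat_of_ord (j ord0) else m.+1.
  by case: jE => ->; rewrite !ffunE eqxx; case: ifP => //= /eqP.
have : (nat_of_ord (j ord0) < 2)%N by case: jE => ->; rewrite ffunE eqxx.
case: ifP => _; last first.
  rewrite divff ?pnatr_eq0// => _ /andP[] + ->; rewrite andbT.
  by apply: le_trans; rewrite lerBlDr -{2}[h]mul1r -mulrDl natr1 divff ?pnatr_eq0.
case: (nat_of_ord (j ord0)) => [|[|//]] _; rewrite ?mul0r ?mul1r => /andP[l u].
  by move: h w0 l u => w w0 l u; apply/andP; split; lra.
by move: h w0 l u => w w0 l u; apply/andP; split; lra.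
Qed.

Lemma cut_cells_cover x : unit_cube d x -> exists j, cut_cell (R := R) j x.
Proof.
move=> /jitter_cells_cover[j xj].
have [jl|jl] := eqVneq j (left_cell n m); last first.
  have [jr|jr] := eqVneq j (right_cell n m); last first.
    by exists j; rewrite /cut_cell (negbTE jl) (negbTE jr).
  have xb : pair_box m x by apply: left_right_cell_sub xj; right.
  have [xc|xc] := pselect (@below_cut R n x).
    by exists (left_cell n m); rewrite cut_cell_left.
  by exists (right_cell n m); rewrite cut_cell_right.
have xb : pair_box m x by apply: left_right_cell_sub xj; left.
have [xc|xc] := pselect (@below_cut R n x).
  by exists (left_cell n m); rewrite cut_cell_left.
by exists (right_cell n m); rewrite cut_cell_right.
Qed.

Lemma cut_cell_sub_cube j x : cut_cell (R := R) j x -> unit_cube d x.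
Proof.
have pair_sub : pair_box m x -> unit_cube d x.
  move=> xb k; have /andP[l u] := xb k; rewrite (le_trans (pair_lo_ge0 m k) l).
  rewrite (le_trans u)// /pair_hi; case: ifP => // _; exact: width_le.
rewrite /cut_cell; case: ifP => _; first by move=> [/pair_sub].
case: ifP => _; first by move=> [/pair_sub].
move=> xj k; have /andP[l u] := xj k.
rewrite (le_trans _ l) ?divr_ge0// (le_trans u)//.
by rewrite ler_pdivrMr// mul1r ler_nat.
Qed.

(** Weak separation by a coordinate hyperplane: it allows common faces, as closed cells have, and
    still excludes common interior points. *)
Definition separated (A B : set (d.-tuple R)) := exists k c,
  (forall x, A x -> tnth x k <= c) /\ (forall x, B x -> c <= tnth x k).

Lemma separated_interior A B x : separated A B ->
  ~ (interior_pt A x /\ interior_pt B x).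
Proof.
move=> [k [c [Ac Bc]]] [[e e0 Ax] [e' e'0 Bx]].
have xc : tnth x k <= c by apply/Ac/Ax => i; rewrite subrr normr0.
(* Shifting down by half the radius stays in [B] but falls strictly below the hyperplane. *)
pose y : d.-tuple R := [tuple tnth x i - e' / 2 | i < d].
have : c <= tnth y k.
  apply/Bc/Bx => i; rewrite tnth_mktuple addrAC subrr add0r normrN gtr0_norm ?divr_gt0//.
  by lra.
by rewrite tnth_mktuple; lra.
Qed.

Lemma separated_cells (i j : I) (k : 'I_d) : (i k < j k)%N ->
  separated (@jitter_cell R d m.+2 i) (@jitter_cell R d m.+2 j).
Proof.
move=> ij; exists k, ((i k).+1%:R * h); split => x xc.
  by have /andP[] := xc k.
have /andP[+ _] := xc k; apply: le_trans.
by rewrite ler_pM2r ?width_gt0// ler_nat.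
Qed.

(** If all coordinates but the first lie in the last interval, the first index is at least 2 and the
    hyperplane at 2h separates. Otherwise some other coordinate ends by 1 - h. *)
Lemma separated_cell_pair j : j != left_cell n m -> j != right_cell n m ->
  separated (@jitter_cell R d m.+2 j) (pair_box m) \/
  separated (pair_box m) (@jitter_cell R d m.+2 j).
Proof.
move=> jl jr.
have [jmax|] := pselect (forall k, k != ord0 -> j k = ord_max).
  right; exists ord0, (2 * h); split => x xc; first by have /andP[] := xc ord0.
  have /andP[+ _] := xc ord0; apply: le_trans; rewrite ler_pM2r ?width_gt0// ler_nat.
  case E: (nat_of_ord (j ord0)) => [|[|//]].
    case/eqP: jl; apply/ffunP => k; rewrite ffunE.
    by case: ifP => [/eqP ->|/negbT /jmax//]; apply/val_inj.
  case/eqP: jr; apply/ffunP => k; rewrite ffunE.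
  by case: ifP => [/eqP ->|/negbT /jmax//]; apply/val_inj.
move=> /existsNP[k /not_implyP[k0 jk]].
left; exists k, (1 - h); split => x xc.
  have /andP[_] := xc k; move/le_trans; apply.
  rewrite lerBrDr -{2}[h]mul1r -mulrDl natr1 ler_pdivrMr// mul1r ler_nat.
  rewrite ltnS ltn_neqAle -ltnS ltn_ord andbT.
  by apply/eqP => jk'; apply: jk; apply/val_inj.
by have /andP[+ _] := xc k; rewrite /pair_lo (negbTE k0).
Qed.

Lemma separated_subset (A A' B B' : set (d.-tuple R)) :
  A `<=` A' -> B `<=` B' -> separated A' B' -> separated A B.
Proof.
by move=> AA BB [k [c [Ac Bc]]]; exists k, c; split => x; [move/AA/Ac|move/BB/Bc].
Qed.

(** A piece inherits from [pair_box] its separation from the other cells. The two pieces are not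
    separated by a coordinate hyperplane, but they are disjoint as sets. *)
Lemma cut_cells_interior (i j : I) x : i != j ->
  ~ (interior_pt (cut_cell (R := R) i) x /\ interior_pt (cut_cell (R := R) j) x).
Proof.
have interior_in A y : interior_pt A y -> A y :> Prop.
  by move=> [e e0]; apply => k; rewrite subrr normr0.
have flip (A B : set (d.-tuple R)) : ~ (interior_pt A x /\ interior_pt B x) ->
    ~ (interior_pt B x /\ interior_pt A x) by move=> nAB [? ?]; apply: nAB.
have pieces A B : A `<=` pair_box m ->
    B != left_cell n m -> B != right_cell n m ->
    ~ (interior_pt A x /\ interior_pt (@jitter_cell R d m.+2 B) x).
  move=> Ab Bl Br; case: (separated_cell_pair Bl Br) => sep.
    by apply/flip/separated_interior; exact: separated_subset Ab sep.
  by apply/separated_interior; apply: separated_subset Ab _ sep.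
have low : lower_piece m `<=` @pair_box R n m by exact: subIsetl.
have upp : upper_piece m `<=` @pair_box R n m by exact: subDsetl.
have disj : ~ (interior_pt (@lower_piece R n m) x /\ interior_pt (@upper_piece R n m) x).
  by move=> [/interior_in[_ ?] /interior_in[_]].
rewrite /cut_cell => ij.
have [il|il] := eqVneq i (left_cell n m).
  have [jl|jl] := eqVneq j (left_cell n m); first by rewrite il jl eqxx in ij.
  by have [jr|jr] := eqVneq j (right_cell n m); [exact: disj|exact: pieces].
have [ir|ir] := eqVneq i (right_cell n m).
  have [jl|jl] := eqVneq j (left_cell n m); first exact: flip.
  have [jr|jr] := eqVneq j (right_cell n m); first by rewrite ir jr eqxx in ij.
  exact: pieces.
have [jl|jl] := eqVneq j (left_cell n m); first by apply: flip; exact: pieces.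
have [jr|jr] := eqVneq j (right_cell n m); first by apply: flip; exact: pieces.
have [k ijk] : exists k, i k != j k.
  by apply/existsP; apply: contraNT ij => /existsPn H; apply/eqP/ffunP => k; apply/eqP/negPn/H.
have [lt|gt|/val_inj eq] := ltngtP (i k) (j k).
- exact/separated_interior/(separated_cells lt).
- exact/flip/separated_interior/(separated_cells gt).
- by rewrite eq eqxx in ijk.
Qed.

End cut_cells_partition_cube.

(** * The cut cells as a sequence, and the strict inequality of means *)

Section cut_cells_properties.
Context {R : realType}.
Variables n m : nat.
Local Notation I := {ffun 'I_n.+2 -> 'I_m.+2}.
Local Notation Om := [seq cut_cell (R := R) j | j <- enum I].

(** The equation for [i] turns distinct positions in the sequence into distinct labels. *)
Lemma nth_cut_cells i : (i < size Om)%N ->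
  exists2 j : I, nth set0 Om i = cut_cell j & i = index j (enum I).
Proof.
rewrite size_map => i_lt; exists (nth (left_cell n m) (enum I) i).
  exact: nth_map.
by rewrite index_uniq ?enum_uniq.
Qed.

Lemma size_cut_cells : size Om = (m.+2 ^ n.+2)%N.
Proof. by rewrite size_map -cardE card_ffun !card_ord. Qed.

Lemma cut_cells_partition : is_partition (unit_cube n.+2) Om.
Proof.
split.
- move=> i /nth_cut_cells[j -> _].
  by have [? /andP[]] := finite_positive_cut_cell (R := R) j.
- move=> x; split=> [/(cut_cells_cover m)[j xj]|[i /nth_cut_cells[j -> _]]]; last first.
    exact: cut_cell_sub_cube.
  have j_lt : (index j (enum I) < size (enum I))%N by rewrite index_mem mem_enum.
  exists (index j (enum I)); first by rewrite size_map.
  by rewrite (nth_map j)// nth_index// mem_enum.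
- move=> i i' /nth_cut_cells[j -> ->] /nth_cut_cells[j' -> ->] jj' x.
  by apply: cut_cells_interior; apply: contra_not_neq jj' => ->.
Qed.

Lemma cut_cells_mean_lt :
  (mean_L2_discr_sq Om < mean_L2_discr_sq (@jittered R n.+2 m.+2))%E.
Proof.
apply: (mean_L2_discr_sq_lt (left_neq_right n m)).
- exact: finite_positive_jitter_cell.
- exact: finite_positive_cut_cell.
- by move=> j jl jr; rewrite /cut_cell (negbTE jl) (negbTE jr).
- by move=> x; rewrite cut_cell_left cut_cell_right; exact: box_prob_pieces.
- exact: leb_int_gap_lt.
Qed.

End cut_cells_properties.

Theorem theorem1 (R : realType) (d m : nat) :
  (2 <= d)%N -> (2 <= m)%N ->
  exists Om : seq (set (d.-tuple R)),
    [/\ size Om = (m ^ d)%N,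
        is_partition (unit_cube d) Om,
        convex_partition Om,
        equivolume Om
      & (mean_L2_discr_sq Om < mean_L2_discr_sq (@jittered R d m))%E].
Proof.
case: d => [|[|n]]//; case: m => [|[|k]]// _ _.
exists [seq cut_cell (R := R) j | j <- enum {ffun 'I_n.+2 -> 'I_k.+2}]; split.
- exact: size_cut_cells.
- exact: cut_cells_partition.
- by move=> i /nth_cut_cells[j -> _]; exact: convex_cut_cell.
- by move=> i i' /nth_cut_cells[j -> _] /nth_cut_cells[j' -> _]; rewrite !vol_cut_cell.
- exact: cut_cells_mean_lt.
Qed.
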